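(* Let $x_*$ be an index-1 saddle of $E$ with minimal eigenpair $(\lambda_*, v_* )$. Then there exist a radius $r$, a maximal dimer length $h_0$ and maximal step sizes $\bar\alpha$ and $\bar\beta$ (independent of one another), as well as a dimer saddle $(x_h, v_h, \lambda_h)$, such that the following hold for all $h \leq h_0$. (a) Let $x_0 \in B_r(x_* )$, $v_0 \in B_r(v_* )$, $\sup_k \alpha_k \leq \bar\alpha$, $\sup_k \beta_k \leq \bar\beta$, $\inf_k \alpha_k > 0$, $\inf_k \beta_k > 0$, and let $(x_k, v_k)$ be the iterates generated by Algorithm 1. Then there exist $C > 0$, $\eta \in (0,1)$ such that $$\| x_k - x_h \| + \| v_k - v_h \| \leq C \eta^k \big( \|x_0-x_h\|+\|v_0-v_h\| \big).$$ (b) Let $x_0 \in B_r(x_* )$, $h\le h_0$, $\sup_k \alpha_k \leq \bar\alpha$, $\inf_k \alpha_k > 0$. Then Algorithm 2 is well-defined (i.e., the minimisation step defining $v_k$ has a unique solution) and there exists $\eta \in (0,1)$ such that $$\| x_{k+1} - x_h \| \leq \eta \| x_k - x_h \| \qquad \text{for all } k \geq 0.$$ Moreover, there exists a constant $C$ such that $\|v_k - v_h\|\leq C \| x_k - x_h \|$.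
   Context: $X$ is a real Hilbert space with inner product $x\cdot y$ and norm $\|x\|$; $I$ is the identity, $(x\otimes y)z = (y\cdot z)x$, and $B_r(x)$ is the ball of radius $r$ about $x$. $E \in C^4(X)$ is real-valued, $\nabla E(x)\in X$ is its gradient and $\nabla^2 E(x)\in L(X)$ its Hessian. A minimal eigenpair of a bounded linear operator $A$ is a pair $(\lambda,v)$ with $Av=\lambda v$ and $\lambda=\inf\sigma(A)$, where $\sigma(A)$ is the spectrum. $A$ has index-1 saddle structure if there exists a unique minimal eigenpair $(\lambda,v)$, with $\lambda<0$, and $A$ is positive definite in $\{v\}^\perp$. $x_*$ is an index-1 saddle of $E$ if $\nabla E(x_* )=0$ and $\nabla^2E(x_* )$ has index-1 saddle structure; $(\lambda_*,v_* )$ is then the minimal eigenpair of $\nabla^2E(x_* )$, with $\|v_*\|=1$. For $h>0$ let $\mathcal{E}_h(x,v) := \frac12(E(x+hv)+E(x-hv))$, so $\nabla_x\mathcal{E}_h(x,v)=\frac12(\nabla E(x+hv)+\nabla E(x-hv))$ and $\nabla_v\mathcal{E}_h(x,v)=\frac h2(\nabla E(x+hv)-\nabla E(x-hv))$. A dimer saddle (for dimer length $h$) is a triple $(x_h,v_h,\lambda_h)\in X\times X\times\mathbb{R}$ with $\nabla_x\mathcal{E}_h(x_h,v_h)=0$, $h^{-2}\nabla_v\mathcal{E}_h(x_h,v_h)=\lambda_hv_h$, $\|v_h\|=1$. Algorithm 1 (given $x_0, v_0\in X$ with $\|v_0\|=1$, $h>0$, step lengths $(\alpha_k),(\beta_k)$):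 for $k=0,1,2,\dots$ set $s_k := -(I-v_k\otimes v_k)h^{-2}\nabla_v\mathcal{E}_h(x_k,v_k)$; $v_{k+1} := \cos(\|s_k\|\beta_k)v_k+\sin(\|s_k\|\beta_k)\frac{s_k}{\|s_k\|}$; $x_{k+1} := x_k-\alpha_k(I-2v_k\otimes v_k)\nabla_x\mathcal{E}_h(x_k,v_k)$. Algorithm 2 (given $x_0\in X$, $h>0$, $(\alpha_k)$): for $k=0,1,2,\dots$ take $v_k\in\arg\min_{\|v\|=1}\mathcal{E}_h(x_k,v)$ and set $x_{k+1}:=x_k-\alpha_k(I-2v_k\otimes v_k)\nabla_x\mathcal{E}_h(x_k,v_k)$.
   Formalization: Since E_h(x,v)=E_h(x,-v), the minimiser in (b) is shown unique up to sign, and the bound on v_k is for min(‖v_k-v_h‖,‖v_k+v_h‖); ''positive definite in {v}^⊥'' is read as coercive, ''unique minimal eigenpair'' as unique up to scaling of v. *)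

(* Defs.v *)
From HB Require Import structures.
From mathcomp Require Import all_boot all_order all_algebra.
From mathcomp Require Import sesquilinear.
From mathcomp Require Import all_classical all_reals all_analysis.

Set Implicit Arguments.
Unset Strict Implicit.
Unset Printing Implicit Defensive.
Import Order.TTheory GRing.Theory Num.Theory.
Import numFieldNormedType.Exports.

Local Open Scope classical_set_scope.
Local Open Scope ring_scope.

HB.mixin Record CompleteNormedModule_isHilbert (R : realType) X
    & CompleteNormedModule R X := {
  dotp : {dot X for idfun};
  dotpE : forall x : X, dotp x x = `|x| ^+ 2
}.

#[short(type="hilbertType")]
HB.structure Definition Hilbert (R : realType) :=
  {X of CompleteNormedModule_isHilbert R X & CompleteNormedModule R X}.

Section ContinuousLinearMaps.
Context {R : realType} {V W : normedModType R}.

Definition clin_pred : {pred V -> W} := fun f => `[< linear f /\ continuous f >].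

Lemma clin_submod_closed : submod_closed clin_pred.
Proof.
split=> [|a f g /asboolP[lf cf] /asboolP[lg cg]]; apply/asboolP; split.
- by move=> k u v; rewrite scaler0 addr0.
- by move=> x; apply: cvg_cst.
- by move=> k u v; rewrite !fctE /= lf lg !scalerDr !scalerA mulrC addrACA.
- by move=> x; apply: cvgD; [apply: cvgZl_tmp; exact: cf|exact: cg].
Qed.

HB.instance Definition _ :=
  GRing.isSubmodClosed.Build R (V -> W) clin_pred clin_submod_closed.

Record clin := Clin { clin_fun :> V -> W ; clinP : clin_fun \in clin_pred }.

HB.instance Definition _ := [isSub for clin_fun].
HB.instance Definition _ := [Choice of clin by <:].
HB.instance Definition _ := [SubChoice_isSubLmodule of clin by <:].

Lemma clin_linear (f : clin) : linear f.
Proof. by have /asboolP[] := clinP f. Qed.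

Lemma clin_continuous (f : clin) : continuous f.
Proof. by have /asboolP[] := clinP f. Qed.

HB.instance Definition _ (f : clin) :=
  GRing.isLinear.Build R V W *:%R (clin_fun f) (clin_linear f).

(* [opnorm_set f] contains 0 = |f 0| and is bounded because f is continuous,
   so its [sup] is a genuine supremum ([opnorm_has_sup]). *)
Definition opnorm_set (f : clin) : set R :=
  [set `|f x| | x in [set x | `|x| <= 1]].
Definition opnorm (f : clin) : R := sup (opnorm_set f).

Lemma opnorm_has_sup (f : clin) : has_sup (opnorm_set f).
Proof.
split; first by exists `|f 0|, 0 => //=; rewrite normr0.
have := @continuous_linear_bounded _ V W 0 f (@clin_continuous f 0).
move=> /linear_boundedP [M [_ fM]].
pose M' := Num.max 0 M + 1.
exists M' => _ [x /= x1 <-].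
have MM' : M < M' by rewrite ltr_pwDr// le_max lexx orbT.
rewrite (le_trans (fM _ MM' x))// -[leRHS]mulr1 ler_wpM2l//.
by rewrite addr_ge0// le_max lexx.
Qed.

Lemma opnorm_ge0 (f : clin) : 0 <= opnorm f.
Proof.
apply: (le_trans (normr_ge0 (f 0))); apply: ub_le_sup.
  by case: (opnorm_has_sup f).
by exists 0 => //=; rewrite normr0.
Qed.

Lemma le_opnorm (f : clin) x : `|f x| <= opnorm f * `|x|.
Proof.
have [->|x0] := eqVneq x 0; first by rewrite linear0 !normr0 mulr0.
have nx : 0 < `|x| by rewrite normr_gt0.
rewrite -ler_pdivrMr//.
have -> : `|f x| / `|x| = `|f (`|x|^-1 *: x)|.
  by rewrite linearZ/= normrZ ger0_norm ?invr_ge0// mulrC.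
apply: ub_le_sup; first by case: (opnorm_has_sup f).
exists (`|x|^-1 *: x) => //=.
by rewrite normrZ ger0_norm ?invr_ge0// mulVf// gt_eqF.
Qed.

Lemma opnorm_le (f : clin) (M : R) : 0 <= M -> (forall x, `|f x| <= M * `|x|) ->
  opnorm f <= M.
Proof.
move=> M0 fM; apply: ge_sup; first by case: (opnorm_has_sup f).
move=> _ [x /= x1 <-]; apply: (le_trans (fM x)).
by rewrite -[leRHS]mulr1 ler_wpM2l.
Qed.

Lemma clin_addE (f g : clin) x : (f + g) x = f x + g x. Proof. by []. Qed.
Lemma clin_scaleE (k : R) (f : clin) x : (k *: f) x = k *: f x. Proof. by []. Qed.

Lemma opnormD (f g : clin) : opnorm (f + g) <= opnorm f + opnorm g.
Proof.
apply: opnorm_le => [|x]; first by rewrite addr_ge0// opnorm_ge0.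
by rewrite clin_addE mulrDl (le_trans (ler_normD _ _))// lerD// le_opnorm.
Qed.

Lemma opnormZ (k : R) (f : clin) : opnorm (k *: f) = `|k| * opnorm f.
Proof.
have le_Z c g : opnorm (c *: g) <= `|c| * opnorm g.
  apply: opnorm_le => [|x]; first by rewrite mulr_ge0// opnorm_ge0.
  by rewrite clin_scaleE normrZ -mulrA ler_wpM2l// le_opnorm.
apply/eqP; rewrite eq_le le_Z/=.
have [->|k0] := eqVneq k 0; first by rewrite normr0 mul0r opnorm_ge0.
rewrite -ler_pdivlMl ?normr_gt0// -normfV.
by rewrite -[in leLHS](scale1r f) -(mulVf k0) -scalerA le_Z.
Qed.

Lemma opnorm0_eq0 (f : clin) : opnorm f = 0 -> f = 0.
Proof.
move=> f0; apply: val_inj; apply/funext => x /=.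
by apply/eqP; rewrite -normr_le0 (le_trans (le_opnorm f x))// f0 mul0r.
Qed.

HB.instance Definition _ := Lmodule_isNormed.Build R clin
  opnormD opnormZ opnorm0_eq0.

End ContinuousLinearMaps.
Arguments clin {R} V W.

Notation "''L' ( V , W )" := (clin V W)
  (at level 0, format "''L' ( V ,  W )") : type_scope.

Section Smoothness.
Context {R : realType} {V : normedModType R}.

Fixpoint is_Cn (n : nat) (W : normedModType R) (f : V -> W) : Prop :=
  if n is n'.+1 then
    exists2 Df : V -> 'L(V, W), (forall x, is_diff x f (Df x)) & is_Cn n' Df
  else continuous f.

End Smoothness.
Arguments is_Cn {R V} n {W} f.

Section Hilbert.
Context {R : realType} {X : hilbertType R}.
Implicit Types (x y v w : X) (A : 'L(X, X)) (l : R).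

Definition tensor x y : X -> X := fun z => dotp y z *: x.

Definition grad (f : X -> R) x : X :=
  get [set g : X | is_diff x (f : X -> R^o) (dotp g)].

Definition hess (f : X -> R) x : 'L(X, X) :=
  get [set A : 'L(X, X) | is_diff x (grad f) A].

Definition spectrum A : set R :=
  [set l | ~ exists B : 'L(X, X),
    (forall x, B (A x - l *: x) = x) /\ (forall x, A (B x) - l *: B x = x)].

Definition minimal_eigenpair A l v : Prop :=
  [/\ v != 0, A v = l *: v, has_inf (spectrum A) & l = inf (spectrum A)].

(* An eigenvector is never unique, so uniqueness of the eigenpair is up to
   scaling of [v].  In a possibly infinite-dimensional space, positive
   definiteness means a coercivity bound. *)
Definition index1_saddle_structure A : Prop :=
  exists l v, [/\ minimal_eigenpair A l v,
    (forall l' v', minimal_eigenpair A l' v' ->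
       l' = l /\ exists c : R, v' = c *: v),
    l < 0 &
    exists2 mu : R, 0 < mu &
      forall w, dotp v w = 0 -> mu * `|w| ^+ 2 <= dotp (A w) w].

Definition index1_saddle (E : X -> R) x : Prop :=
  grad E x = 0 /\ index1_saddle_structure (hess E x).

Section Dimer.
Variables (E : X -> R) (h : R).

Definition dimer_energy x v : R := 2^-1 * (E (x + h *: v) + E (x - h *: v)).

Definition dimer_gradx x v : X := grad (fun y => dimer_energy y v) x.
Definition dimer_gradv x v : X := grad (fun w => dimer_energy x w) v.

Definition dimer_saddle x v l : Prop :=
  [/\ dimer_gradx x v = 0, h ^- 2 *: dimer_gradv x v = l *: v & `|v| = 1].

Definition dimer_step_x (alpha : R) x v : X :=
  x - alpha *: (dimer_gradx x v - 2 *: tensor v v (dimer_gradx x v)).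

Definition dimer_dir x v : X :=
  - (h ^- 2 *: dimer_gradv x v - tensor v v (h ^- 2 *: dimer_gradv x v)).

(* When the direction [s] is 0, the quotient is 0 (the inverse of 0 is 0) and
   the step leaves [v] unchanged. *)
Definition dimer_step_v (beta : R) x v : X :=
  let s := dimer_dir x v in
  cos (`|s| * beta) *: v + sin (`|s| * beta) *: (`|s|^-1 *: s).

Fixpoint algorithm1 (alpha beta : nat -> R) (x0 v0 : X) (k : nat) : X * X :=
  if k is k'.+1 then
    let: (x, v) := algorithm1 alpha beta x0 v0 k' in
    (dimer_step_x (alpha k') x v, dimer_step_v (beta k') x v)
  else (x0, v0).

Definition dimer_argmin x : set X :=
  [set v | `|v| = 1 /\
    forall w, `|w| = 1 -> dimer_energy x v <= dimer_energy x w].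

(* The argmin is closed under negation, so the algorithm is a relation: [v k]
   may be any of the minimisers. *)
Definition algorithm2 (alpha : nat -> R) (x0 : X) (x v : nat -> X) : Prop :=
  [/\ x 0%N = x0,
    (forall k, dimer_argmin (x k) (v k)) &
    (forall k, x k.+1 = dimer_step_x (alpha k) (x k) (v k))].

End Dimer.
End Hilbert.

Definition admissible_steps {R : realType} (abar : R) (alpha : nat -> R) : Prop :=
  (ereal_sup [set (alpha k)%:E | k in [set: nat]] <= abar%:E)%E /\
  (0 < ereal_inf [set (alpha k)%:E | k in [set: nat]])%E.

(* Main.v *)
Require Import Defs.
From HB Require Import structures.
From mathcomp Require Import all_boot all_order all_algebra.
From mathcomp Require Import sesquilinear ring lra.
From mathcomp Require Import all_classical all_reals all_analysis.
Import Order.TTheory GRing.Theory Num.Theory.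
Import numFieldNormedType.Exports.
Local Open Scope classical_set_scope.
Local Open Scope ring_scope.

Set Implicit Arguments.
Unset Strict Implicit.
Unset Printing Implicit Defensive.

(** The only analytic input is that [grad E] is differentiable with a derivative
    that is locally Lipschitz and, at [xs], symmetric (Riesz representation,
    Schwarz' theorem, mean value inequality). Consequently, for [x] near [xs],
    [v] near [vs] and small [h], the mean gradient and the finite-difference
    curvature [(grad E (x + h v) - grad E (x - h v)) / (2 h)] have small
    deviations from [hess E xs] applied to [x] and to [v]. The linearised
    [x]-step uses [(1 - 2 vs vs^T) A] and the linearised [v]-step uses
    [A - ls] on the complement of [vs]; both are coercive, so each step contracts
    its own variable, the [x]-step feels [v] only through a small factor, and the
    [v]-step feels [x] through a bounded one. Hence [max (|dx|, delta |dv|)]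
    contracts for a suitable weight [delta], with step bounds chosen
    independently. Banach's theorem at fixed [x] gives a critical direction
    [vb x], Lipschitz in [x]; applied once more to the [x]-step along [vb] it
    gives the dimer saddle. A quadratic lower bound on the energy over the sphere
    shows that the minimisers are exactly [vb x] and [- vb x]. *)

(** * Inner products and Riesz representation *)

(** To keep the two step bounds independent, each error is kept proportional to the step that causes
    it: the [x]-step has rate [1 - a * c] and coupling [a * eps], the [v]-step has rate [1 - b * c]
    and coupling [b * K], so no ratio of step lengths enters. The couplings are lopsided because the
    mean gradient is even in [v]: the first-order effect of turning [v] cancels, so [eps] shrinks
    with the region, while [K] does not. Hence [c], [K] and the step bounds are fixed first, then
    [delta <= c / (2 * K)], then [eps = c * delta / 2], and only then the region. Half of each rate
    pays for the coupling and the other half remains.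

    Two obstacles shape the estimates. Uniformity in [h]: the curvature divides by [2 * h], so every
    difference of gradients in it must be bounded by a multiple of [h]. The sphere: [A - ls]
    vanishes along [vs], but the difference of two unit vectors near [vs] is almost orthogonal to
    [vs], so this degenerate direction is felt only to second order. *)

Section InnerProduct.
Context {R : realType} {X : hilbertType R}.
Implicit Types x y z : X.

Lemma dotpC x y : dotp x y = dotp y x.
Proof. by rewrite hermC/= expr0 mul1r. Qed.

Lemma dotpDl x y z : dotp (x + y) z = dotp x z + dotp y z.
Proof. by rewrite linearDl. Qed.

Lemma dotpZl a x z : dotp (a *: x) z = a * dotp x z.
Proof. by rewrite linearZl_LR. Qed.

Lemma dotpNl x z : dotp (- x) z = - dotp x z.
Proof. by rewrite linearNl. Qed.

Lemma dotpDr x y z : dotp z (x + y) = dotp z x + dotp z y.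
Proof. by rewrite linearDr. Qed.

Lemma dotpZr a x z : dotp z (a *: x) = a * dotp z x.
Proof. by rewrite dotpC dotpZl dotpC. Qed.

Lemma dotpNr x z : dotp z (- x) = - dotp z x.
Proof. by rewrite linearNr. Qed.

Lemma dotp0l x : dotp (0 : X) x = 0. Proof. by rewrite linear0l. Qed.
Lemma dotp0r x : dotp x (0 : X) = 0. Proof. by rewrite linear0r. Qed.

Definition dotp_lin := (dotp0l, dotp0r, dotpDl, dotpDr, dotpNl, dotpNr, dotpZl, dotpZr).

Lemma dotp_norm x : dotp x x = `|x| ^+ 2. Proof. exact: dotpE. Qed.

Lemma normD_sqr x y : `|x + y| ^+ 2 = `|x| ^+ 2 + 2 * dotp x y + `|y| ^+ 2.
Proof. by rewrite -!dotp_norm !dotp_lin (dotpC y x); ring. Qed.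

Lemma normB_sqr x y : `|x - y| ^+ 2 = `|x| ^+ 2 - 2 * dotp x y + `|y| ^+ 2.
Proof. by rewrite normD_sqr dotpNr normrN; ring. Qed.


Lemma cauchy_schwarz x y : `|dotp x y| <= `|x| * `|y|.
Proof.
have [->|y0] := eqVneq y 0; first by rewrite dotp0r !normr0 mulr0.
have yp : 0 < `|y| by rewrite normr_gt0.
(* The component of [x] orthogonal to [y], multiplied by [|y| ^ 2] to avoid a division. *)
have : 0 <= `| `|y| ^+ 2 *: x - dotp x y *: y| ^+ 2 by rewrite exprn_ge0.
rewrite normB_sqr !normrZ dotpZl dotpZr !exprMn !normr_id (@real_normK _ (dotp x y)) ?num_real//.
set d := dotp x y; set a := `|x|; set b := `|y|.
move=> H; rewrite -(@ler_pXn2r _ 2) ?nnegrE ?mulr_ge0 /a /b ?normr_ge0// exprMn real_normK ?num_real// -exprMn -/a -/b.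
have {}H : 0 <= (b ^+ 2) * ((a * b) ^+ 2 - d ^+ 2).
  by move: H; congr (_ <= _); ring.
by move: H; rewrite pmulr_rge0 ?subr_ge0// exprn_gt0.
Qed.

Lemma norm_le_dotp x (M : R) : 0 <= M -> (forall u, dotp u x <= M * `|u|) -> `|x| <= M.
Proof.
move=> M0 /(_ x); rewrite dotp_norm expr2.
have [->|x0] := eqVneq x 0; first by rewrite normr0.
by rewrite ler_pM2r// normr_gt0.
Qed.

Lemma dotp_ext x y : (forall z, dotp x z = dotp y z) -> x = y.
Proof.
move=> H; apply/eqP; rewrite -subr_eq0 -normr_eq0 -sqrf_eq0 -dotp_norm.
by rewrite {1}dotpDl dotpNl H subrr.
Qed.

Lemma dotp_continuous (u : X) : continuous (dotp u : X -> R^o).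
Proof.
move=> x; apply/cvgrPdist_lt => e e0.
near=> y.
rewrite -dotpNr -dotpDr.
apply: le_lt_trans (cauchy_schwarz _ _) _.
have u0 : 0 < `|u| + 1 by rewrite ltr_wpDl.
apply: (@le_lt_trans _ _ ((`|u| + 1) * `|x - y|)).
  by rewrite ler_wpM2r// lerDl.
rewrite -ltr_pdivlMl//.
near: y; apply: cvgr_dist_lt; first exact: cvg_id.
by rewrite mulr_gt0// invr_gt0.
Unshelve. all: by end_near. Qed.

End InnerProduct.

(* Identities in a real vector space reduce to ring identities between inner products. *)
Ltac vec_ring := apply: dotp_ext => ?; rewrite ?dotp_lin; ring.

Section Riesz.
Context {R : realType} {X : hilbertType R}.
Variable phi : 'L(X, R^o).
(** The quadratic energy whose Euler equation is [dotp x = phi]; the representing vector is the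
    limit of a minimising sequence. *)
Let J (x : X) : R := 2^-1 * `|x| ^+ 2 - phi x.

Lemma riesz_lower_bound (x : X) : - (2^-1 * opnorm phi ^+ 2) <= J x.
Proof.
rewrite /J; have := le_opnorm phi x; rewrite ler_norml => /andP[_ H].
have := sqr_ge0 (`|x| - opnorm phi); set a := `|x| in H *; set M := opnorm phi in H *.
move: (phi x : R) H => p H H2; nra.
Qed.

Let m : R := inf [set J x | x in setT].

Lemma riesz_inf_le (x : X) : m <= J x.
Proof.
apply: ge_inf; last by exists x.
by exists (- (2^-1 * opnorm phi ^+ 2)) => _ [y _ <-]; exact: riesz_lower_bound.
Qed.

Lemma riesz_inf_adherent (e : R) : 0 < e -> exists x, J x < m + e.
Proof.
move=> e0; have [|_ [x _ <-] ?] := @inf_adherent R [set J x | x in setT] e e0; last by exists x.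
split; first by exists (J 0); exists 0.
by exists (- (2^-1 * opnorm phi ^+ 2)) => _ [y _ <-]; exact: riesz_lower_bound.
Qed.

(** Parallelogram identity: [J x + J y - 2 * J ((x + y) / 2) = |x - y| ^ 2 / 4], and the midpoint
    has energy at least [m]. Minimising sequences are therefore Cauchy. *)
Lemma riesz_near_min (e : R) (x y : X) : J x <= m + e -> J y <= m + e ->
  `|x - y| ^+ 2 <= 8 * e.
Proof.
move=> xe ye.
have := riesz_inf_le (2^-1 *: (x + y)).
move: xe ye; rewrite /J normrZ exprMn normB_sqr normD_sqr linearZ linearD/=.
rewrite ger0_norm// /GRing.scale/=.
set a := `|x| ^+ 2; set b := `|y| ^+ 2; set c := dotp x y.
set p := (phi x : R); set q := (phi y : R) => *; lra.
Qed.

(** Discriminant of the quadratic [t |-> J (x + t w) - m], which is nonnegative. Stating it for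
    near-minimisers lets the Euler equation pass to the limit through the continuity of [dotp w]
    alone. *)
Lemma riesz_near_crit (e : R) (x w : X) : 0 <= e -> J x <= m + e ->
  (dotp x w - phi w) ^+ 2 <= 2 * e * `|w| ^+ 2.
Proof.
move=> e0 xe.
have H t : 0 <= e + t * (dotp x w - phi w) + 2^-1 * t ^+ 2 * `|w| ^+ 2.
  have := riesz_inf_le (x + t *: w); move: xe.
  rewrite /J normD_sqr dotpZr linearD linearZ/= normrZ exprMn real_normK ?num_real//.
  rewrite /GRing.scale/=.
  set a := `|x| ^+ 2; set b := `|w| ^+ 2; set c := dotp x w.
  set p := (phi x : R); set q := (phi w : R) => *; nra.
set d := (dotp x w - phi w) in H *; set b := `|w| ^+ 2 in H *.
have b0 : 0 <= b by rewrite exprn_ge0.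
have [bz|bnz] := eqVneq b 0.
  rewrite bz mulr0; have [->|dn] := eqVneq d 0; first by rewrite expr0n.
  (* The quadratic is affine here, and this [t] gives it the value -1. *)
  have := H (- (e + 1) / d); rewrite bz mulr0 addr0 divfK//; lra.
have bp : 0 < b by rewrite lt_def bnz.
have := H (- d / b).
have -> : e + - d / b * d + 2^-1 * (- d / b) ^+ 2 * b = e - 2^-1 * (d ^+ 2 / b).
  by field.
move=> K; rewrite -ler_pdivrMr//; lra.
Qed.

Lemma riesz_representation : exists g : X, forall x, phi x = dotp g x.
Proof.
have /choice[u Hu] : forall n, exists x, J x < m + n.+1%:R^-1.
  by move=> n; apply: riesz_inf_adherent; rewrite invr_gt0.
have uc : cvgn u.
  apply/cauchy_cvgP; apply/cauchy_exP => e e0.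
  have [N HN] : exists N : nat, 8 * N.+1%:R^-1 < e ^+ 2.
    have e2 : 0 < e ^+ 2 / 8 by rewrite divr_gt0// exprn_gt0.
    have [N _ HN] := near_infty_natSinv_lt (PosNum e2).
    exists N; rewrite mulrC -ltr_pdivlMr//; by apply: (HN N) => /=.
  exists (u N); exists N => // n /= Nn.
  rewrite -ball_normE/=.
  rewrite -(@ltr_pXn2r _ 2) ?nnegrE ?(ltW e0)//.
  apply: le_lt_trans HN; apply: riesz_near_min; first exact/ltW.
  apply: (le_trans (ltW (Hu n))); rewrite lerD2l lef_pV2 ?posrE//.
  by rewrite ler_nat ltnS.
exists (limn u) => w; apply/eqP; rewrite eq_sym -subr_eq0; apply/eqP.
have c1 : (dotp w (u n) - phi w)%R @[n --> \oo] --> (dotp w (limn u) - phi w : R^o).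
  apply: cvgB; last exact: cvg_cst.
  by apply: continuous_cvg; [exact: dotp_continuous|].
rewrite dotpC; apply/eqP; rewrite -normr_le0; apply/ler_addgt0Pl => e e0.
rewrite addr0.
(* Chosen so that [riesz_near_crit] yields a squared error of at most [e ^ 2]; the [+ 1] covers
   [w = 0]. *)
have e2 : 0 < e ^+ 2 / (2 * `|w| ^+ 2 + 1).
  by rewrite divr_gt0 ?exprn_gt0// ltr_wpDl// mulr_ge0// exprn_ge0.
have [N _ HN] := near_infty_natSinv_lt (PosNum e2).
apply: (cvgr_to_le (cvg_norm c1)); exists N => // n Nn /=.
rewrite -(@ler_pXn2r _ 2) ?nnegrE ?(ltW e0)//.
rewrite real_normK ?num_real// dotpC.
apply: le_trans (@riesz_near_crit n.+1%:R^-1 _ _ _ (ltW (Hu n))) _ => //.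
have := HN n Nn; rewrite /= ltr_pdivlMr; last first.
  by rewrite ltr_wpDl// mulr_ge0// exprn_ge0.
set k := n.+1%:R^-1; have : 0 <= k by rewrite invr_ge0.
have : 0 <= `|w| ^+ 2 by rewrite exprn_ge0.
nra.
Unshelve. all: by end_near. Qed.
End Riesz.

(** * Differential calculus *)

Section Differential.
Context {R : realType} {V W : normedModType R}.

Lemma is_diff_unique (f d1 d2 : V -> W) x :
  is_diff x f d1 -> is_diff x f d2 -> d1 = d2.
Proof. by move=> [_ <-] [_ <-]. Qed.

Lemma is_diff_clin (f : 'L(V, W)) x : is_diff x f f.
Proof.
have c := @clin_continuous _ _ _ f.
by apply: DiffDef; [exact: linear_differentiable|exact: diff_lin].
Qed.

Lemma is_diff_shift (a x : V) : is_diff x (fun y => y + a) id.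
Proof.
have h : is_diff x (id + cst a) (id + 0) := is_diffD (is_diff_id x) (is_diff_cst a x).
by apply: is_diff_eq h _; apply/funext => y /=; rewrite fctE /= addr0.
Qed.

Lemma is_diff_line (p w : V) (t : R) :
  is_diff t (fun s : R => p + s *: w) (fun s : R => s *: w).
Proof.
have h : is_diff t (cst p + *:%R^~ w) (0 + *:%R^~ w : R -> V) := is_diffD (is_diff_cst p t) (is_diff_scalel t w).
by apply: is_diff_eq h _; apply/funext => y /=; rewrite fctE /= add0r.
Qed.

Lemma clin_predP (f : V -> W) (M : R) :
  linear f -> (forall x, `|f x| <= M * `|x|) -> f \in clin_pred.
Proof.
move=> lf fM; apply/asboolP; split=> // x; apply/cvgrPdist_le => e e0.
have M0 : 0 < `|M| + 1 by rewrite ltr_wpDl.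
apply/nbhs_normP; exists (e / (`|M| + 1)) => /=; first exact: divr_gt0.
move=> y /= xy.
have -> : f x - f y = f (x - y).
  by have := lf (- 1) y x; rewrite !scaleN1r (addrC (- y)) (addrC (- f y)) => ->.
apply: le_trans (fM _) _.
apply: (@le_trans _ _ ((`|M| + 1) * `|x - y|)).
  by rewrite ler_wpM2r// (le_trans (ler_norm _))// lerDl.
by rewrite mulrC -ler_pdivlMr//; exact: ltW.
Qed.

Lemma continuous_modulus (f : V -> W) x (e : R) : continuous f -> 0 < e ->
  exists2 d : R, 0 < d & forall y, `|x - y| < d -> `|f x - f y| <= e.
Proof.
move=> fc e0; have /cvgrPdist_le fx := fc x.
by have /nbhs_normP[d d0 Hd] := fx e e0; exists d => // y; exact: Hd.
Qed.

End Differential.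

Section Evaluation.
Context {R : realType} {V W : normedModType R}.

(** Evaluation as a bounded operator, so that the chain rule differentiates [y |-> F y z]. *)
Lemma eval_clinP (z : V) : (fun f : 'L(V, W) => f z) \in clin_pred.
Proof.
by apply: (@clin_predP _ 'L(V, W) W _ `|z|) => // f; rewrite mulrC le_opnorm.
Qed.

Definition eval_clin (z : V) : 'L('L(V, W), W) := Clin (eval_clinP z).

End Evaluation.

Section DerivLine.
Context {R : realType} {V : normedModType R}.

Lemma is_derive_line (f df : V -> R^o) (p w : V) (t : R) :
  is_diff (p + t *: w) f df -> is_derive t 1 (fun s : R => f (p + s *: w)) (df w).
Proof.
move=> h.
have hc := @is_diff_comp _ _ _ _ _ _ _ _ _ (is_diff_line p w t) h.
apply: DeriveDef; first by apply: diff_derivable; exact: ex_diff.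
rewrite deriveE; last exact: ex_diff.
by rewrite diff_val/= scale1r.
Qed.

(** The mean value theorem needs scalar values. Vector estimates are therefore tested against a
    fixed vector first, and [norm_le_dotp] recovers the norm. *)
Lemma mvt_line (f : V -> R^o) (df : V -> V -> R^o) (p w : V) :
  (forall x, is_diff x f (df x)) ->
  exists2 c : R, 0 <= c <= 1 & f (p + w) - f p = df (p + c *: w) w.
Proof.
move=> h.
have d (s : R) := @is_derive_line _ _ p w s (h (p + s *: w)).
have cont : {within `[0, 1], continuous (fun s : R => f (p + s *: w))}.
  by apply: derivable_within_continuous => s _; have [] := d s.
have [c] := MVT_segment ler01 (fun s _ => d s) cont.
by rewrite in_itv/= scale0r addr0 scale1r subr0 mulr1 => c01 ->; exists c.
Qed.
End DerivLine.

Section BilinearBound.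
Context {R : realType} {U V W : normedModType R}.

Lemma clin_sub2E (B C : 'L(U, 'L(V, W))) u v : (B - C) u v = B u v - C u v.
Proof. by have -> : (B - C) u = B u - C u by []. Qed.

Lemma le_opnorm2 (B : 'L(U, 'L(V, W))) u v : `|B u v| <= `|B| * `|u| * `|v|.
Proof.
apply: (le_trans (le_opnorm (B u) v)); apply: ler_wpM2r => //.
exact: (le_opnorm B u).
Qed.

End BilinearBound.

(** * Symmetry of the second derivative *)

Section Schwarz.
Context {R : realType} {V : normedModType R}.
Variables (f : V -> R^o) (D1 : V -> 'L(V, R^o)) (D2 : V -> 'L(V, 'L(V, R^o))).
Hypothesis f1 : forall x, is_diff x f (D1 x).
Hypothesis f2 : forall x, is_diff x D1 (D2 x).

Lemma is_diff_apply (W U : normedModType R) (F : V -> 'L(W, U)) (dF : V -> 'L(W, U))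
    (x : V) (z : W) :
  is_diff x F dF -> is_diff x (fun y => F y z) (fun d => dF d z).
Proof.
move=> h.
exact: (@is_diff_comp _ _ _ _ _ _ _ _ _ h (is_diff_clin (eval_clin z) (F x))).
Qed.

(** Two mean value theorems: the first moves along [t z] in the increment [F], the second along
    [t w] in the derivative of [f] applied to [z]. *)
Lemma second_difference (x w z : V) (t : R) : exists2 p : V,
  `|p - x| <= `|t| * (`|w| + `|z|) &
  f (x + t *: w + t *: z) - f (x + t *: w) - f (x + t *: z) + f x = t ^+ 2 * D2 p w z.
Proof.
pose F y := f (y + t *: w) - f y.
have FD y : is_diff y (F : V -> R^o) (fun d => D1 (y + t *: w) d - D1 y d).
  have h := @is_diff_comp _ _ _ _ _ _ _ _ _ (is_diff_shift (t *: w) y) (f1 (y + t *: w)).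
  exact: (is_diffB h (f1 y)).
have [c c01 /= Hc] := mvt_line x (t *: z) FD.
have [e e01 /= He] := mvt_line (x + c *: (t *: z)) (t *: w)
  (fun y => is_diff_apply z (f2 y)).
exists (x + c *: (t *: z) + e *: (t *: w)).
  rewrite -!addrA addrC -!addrA addNr addr0 !scalerA.
  apply: (le_trans (ler_normD _ _)); rewrite !normrZ ?normrM mulrDr addrC.
  have /andP[c0 c1] := c01; have /andP[e0 e1] := e01.
  rewrite (ger0_norm c0) (ger0_norm e0).
  by apply: lerD; rewrite ler_wpM2r// ler_piMl.
have -> : f (x + t *: w + t *: z) - f (x + t *: w) - f (x + t *: z) + f x
    = F (x + t *: z) - F x.
  by rewrite /F (addrAC x (t *: z)); ring.
have lZ (l : 'L(V, R^o)) (u : V) : l (t *: u) = t * l u by rewrite linearZ.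
have lZ2 (l : 'L(V, 'L(V, R^o))) (u : V) : l (t *: u) z = t * l u z by rewrite linearZ.
by rewrite Hc !lZ -mulrBr He lZ2 mulrA.
Qed.

Hypothesis D2c : continuous D2.

(** The second difference is symmetric in [w] and [z], so [D2 p w z = D2 q z w] at two points close
    to [x]; continuity of [D2] moves both to [x]. *)
Lemma hessian_symmetric x w z : D2 x w z = D2 x z w.
Proof.
apply/eqP; rewrite -subr_eq0 -normr_le0; apply/ler_addgt0Pl => e e0; rewrite addr0.
(* Each of the two replacements by [x] costs at most [e / K * |w| * |z| <= e / 2]. *)
pose K := 2 * (`|w| * `|z| + 1).
have K0 : 0 < K by rewrite mulr_gt0// ltr_wpDl// mulr_ge0.
have [d d0 Hd] := continuous_modulus x D2c (divr_gt0 e0 K0).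
have N0 : 0 < `|w| + `|z| + 1 by rewrite ltr_wpDl// addr_ge0.
pose t := d / 2 / (`|w| + `|z| + 1).
have t0 : 0 < t by rewrite !divr_gt0.
have td : `|t| * (`|w| + `|z|) < d.
  rewrite gtr0_norm// /t mulrAC ltr_pdivrMr//.
  have : 0 <= `|w| + `|z| by rewrite addr_ge0.
  by move: (`|w| + `|z|) => q q0; nra.
have [p pt Hp] := second_difference x w z t.
have [q qt Hq] := second_difference x z w t.
have pq : D2 p w z = D2 q z w.
  apply: (@mulfI _ (t ^+ 2)); first by rewrite expf_neq0// gt_eqF.
  by rewrite -Hp -Hq (addrAC x (t *: w)); ring.
have est (a b u v : V) : `|D2 a u v - D2 b u v| <= `|D2 a - D2 b| * `|u| * `|v|.
  by rewrite -clin_sub2E; exact: le_opnorm2.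
have pd : `|D2 x - D2 p| <= e / K.
  by apply: Hd => /=; rewrite distrC (le_lt_trans pt).
have qd : `|D2 x - D2 q| <= e / K.
  by apply: Hd => /=; rewrite distrC (le_lt_trans qt)// (addrC `|z|).
rewrite (_ : D2 x w z - D2 x z w = (D2 x w z - D2 p w z) - (D2 x z w - D2 q z w)); last first.
  by rewrite pq; ring.
apply: le_trans (ler_normB _ _) _.
have h1 := est x p w z; have h2 := est x q z w.
have eK : e = e / K * (2 * (`|w| * `|z| + 1)) by rewrite -/K divfK// gt_eqF.
have eK0 : 0 <= e / K by rewrite divr_ge0 ?ltW.
rewrite [leRHS]eK.
have h3 : `|D2 x - D2 p| * `|w| * `|z| <= e / K * `|w| * `|z|.
  exact: (ler_wpM2r (normr_ge0 z) (ler_wpM2r (normr_ge0 w) pd)).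
have h4 : `|D2 x - D2 q| * `|z| * `|w| <= e / K * `|z| * `|w|.
  exact: (ler_wpM2r (normr_ge0 w) (ler_wpM2r (normr_ge0 z) qd)).
have h5 := mulr_ge0 eK0 (mulr_ge0 (normr_ge0 w) (normr_ge0 z)).
apply: (le_trans (lerD (le_trans h1 h3) (le_trans h2 h4))).
clearbody K; clear -h5 eK0; move: h5 eK0.
by move: (e / K : R) (`|w| : R) (`|z| : R) => k a b ? ?; lra.
Qed.

End Schwarz.

Section LocalEstimates.
Context {R : realType} {V : hilbertType R}.
Variables (f : V -> R^o) (D1 : V -> 'L(V, R^o)) (D2 : V -> 'L(V, 'L(V, R^o))).
Variable (D3 : V -> 'L(V, 'L(V, 'L(V, R^o)))).
Hypothesis f1 : forall x, is_diff x f (D1 x).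
Hypothesis f2 : forall x, is_diff x D1 (D2 x).
Hypothesis f3 : forall x, is_diff x D2 (D3 x).
Hypothesis D3c : continuous D3.
Variable xs : V.

(** Continuity bounds [D3] by [|D3 xs| + 1] on a ball, which contains the segments joining its
    points. *)
Lemma hessian_locally_lipschitz : exists2 L : R, 0 < L & exists2 rho : R, 0 < rho &
  forall x y w z, `|x - xs| <= rho -> `|y - xs| <= rho ->
  `|D2 x w z - D2 y w z| <= L * `|x - y| * `|w| * `|z|.
Proof.
have [d d0 Hd] := continuous_modulus xs D3c ltr01.
exists (`|D3 xs| + 1); first by rewrite ltr_wpDl.
exists (d / 2); first by rewrite divr_gt0.
move=> x y w z xd yd.
have [c /andP[c0 c1] /= Hc] := mvt_line y (x - y)
  (fun u => is_diff_apply z (is_diff_apply w (f3 u))).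
rewrite (addrC y) subrK in Hc; rewrite Hc.
apply: (le_trans (le_opnorm2 _ _ _)); apply: ler_wpM2r => //; apply: ler_wpM2r => //.
apply: (le_trans (le_opnorm (D3 _) _)); apply: ler_wpM2r => //.
set p := y + c *: (x - y).
have pd : `|xs - p| < d.
  have -> : xs - p = - ((1 - c) *: (y - xs) + c *: (x - xs)).
    by rewrite /p; vec_ring.
  rewrite normrN; apply: le_lt_trans (ler_normD _ _) _.
  rewrite !normrZ ger0_norm ?subr_ge0// (ger0_norm c0).
  have h1 : (1 - c) * `|y - xs| <= (1 - c) * (d / 2) by rewrite ler_wpM2l// subr_ge0.
  have h2 : c * `|x - xs| <= c * (d / 2) by rewrite ler_wpM2l.
  apply: le_lt_trans (lerD h1 h2) _.
  by rewrite -mulrDl subrK mul1r; lra.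
have h2 := lerB_dist (D3 p) (D3 xs); rewrite distrC in h2.
by have := le_trans h2 (Hd p pd); rewrite lerBlDl addrC.
Qed.

End LocalEstimates.

(** * Gradient and Hessian through the Riesz operator *)

Section Gradient.
Context {R : realType} {X : hilbertType R}.
Implicit Types (f : X -> R) (x : X).

Lemma grad_eq f x g : is_diff x (f : X -> R^o) (dotp g) -> grad f x = g.
Proof.
move=> fg; apply: dotp_ext => z; rewrite /grad.
set S := [set _ | _]; have : S (get S) by apply: getPex; exists g.
by move=> /(is_diff_unique fg) /(congr1 (fun F => F z)).
Qed.

Lemma is_diff_grad f x (phi : 'L(X, R^o)) :
  is_diff x (f : X -> R^o) phi -> is_diff x (f : X -> R^o) (dotp (grad f x)).
Proof.
move=> fphi; have [g phig] := riesz_representation phi.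
have fg : is_diff x (f : X -> R^o) (dotp g).
  by rewrite (_ : dotp g = phi) //; apply/funext => z.
by rewrite (grad_eq fg).
Qed.

(** As a bounded operator, the Riesz map gives [grad f = r \o D1], which the chain rule
    differentiates to the Hessian [r \o D2 x]. *)
Lemma riesz_map : exists r : 'L('L(X, R^o), X), forall phi x, dotp (r phi) x = phi x.
Proof.
have /choice[r Hr] := @riesz_representation R X.
have rP : r \in clin_pred.
  apply: (@clin_predP _ 'L(X, R^o) X r 1).
    by move=> a p q; apply: dotp_ext => z; rewrite dotpDl dotpZl -!Hr.
  move=> phi; rewrite mul1r; apply: norm_le_dotp => // u.
  rewrite dotpC -Hr; apply: le_trans (ler_norm _) _; exact: le_opnorm.
by exists (Clin rP) => phi x; rewrite -Hr.
Qed.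

Lemma hess_dotp f (D1 : X -> 'L(X, R^o)) (D2 : X -> 'L(X, 'L(X, R^o))) x :
  (forall x, is_diff x (f : X -> R^o) (D1 x)) -> (forall x, is_diff x D1 (D2 x)) ->
  forall w z, dotp (hess f x w) z = D2 x w z.
Proof.
move=> f1 f2; have [r Hr] := riesz_map.
have gE : grad f = r \o D1.
  apply/funext => y; apply: grad_eq.
  by rewrite (_ : dotp _ = D1 y)//; apply/funext => z; rewrite Hr.
have AP : r \o D2 x \in clin_pred.
  apply: (@clin_predP _ X X _ (`|r| * `|D2 x|)) => [a u v|u].
    by rewrite /= !linearP.
  apply: le_trans (le_opnorm r (D2 x u)) _; rewrite -mulrA.
  by apply: ler_wpM2l; [exact: opnorm_ge0|exact: le_opnorm].
have fA : is_diff x (grad f) (Clin AP).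
  rewrite gE; exact: (is_diff_comp (f2 x) (is_diff_clin r (D1 x))).
move=> w z; rewrite /hess; set S := [set _ | _].
have : S (get S) by apply: getPex; exists (Clin AP).
by move=> /(is_diff_unique fA) /(congr1 (fun F => F w)) /= <-; rewrite Hr.
Qed.

Lemma is_CnS n (W : normedModType R) (F : X -> W) : is_Cn n.+1 F -> is_Cn n F.
Proof.
elim: n W F => [|n IH] W F [DF FD DFc]; last by exists DF => //; exact: IH.
by move=> x; apply: differentiable_continuous; case: (FD x).
Qed.

Lemma is_diff_shift_comp f (D : X -> X) x a (f1 : forall x, is_diff x (f : X -> R^o) (dotp (D x))) :
  is_diff x ((fun y => f (y + a)) : X -> R^o) (dotp (D (x + a))).
Proof. exact: (is_diff_comp (is_diff_shift a x) (f1 (x + a))). Qed.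

End Gradient.

Section DimerGradient.
Context {R : realType} {X : hilbertType R}.
Variables (E : X -> R) (h : R).
Hypothesis E1 : forall x, is_diff x (E : X -> R^o) (dotp (grad E x)).

Lemma dimer_gradxE x v : dimer_gradx E h x v =
  2^-1 *: (grad E (x + h *: v) + grad E (x - h *: v)).
Proof.
apply: grad_eq.
have d := is_diffZ 2^-1 (is_diffD (is_diff_shift_comp x (h *: v) E1)
  (is_diff_shift_comp x (- (h *: v)) E1)).
apply: is_diff_eq d _; apply/funext => z.
by rewrite /= dotpZl dotpDl.
Qed.

Lemma is_diff_affine (x v : X) (a : R) : is_diff v (fun w => x + a *: w) (fun w => a *: w).
Proof.
have d : is_diff v (cst x + *:%R a) (0 + *:%R a : X -> X) :=
  is_diffD (is_diff_cst x v) (is_diff_scaler a v).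
by apply: is_diff_eq d _; apply/funext => y /=; rewrite fctE /= add0r.
Qed.

Lemma dimer_gradvE x v : dimer_gradv E h x v =
  (h / 2) *: (grad E (x + h *: v) - grad E (x - h *: v)).
Proof.
apply: grad_eq.
have d1 := is_diff_comp (is_diff_affine x v h) (E1 (x + h *: v)).
have d2 := is_diff_comp (is_diff_affine x v (- h)) (E1 (x + (- h) *: v)).
have d := is_diffZ 2^-1 (is_diffD d1 d2).
rewrite (_ : (fun w => dimer_energy E h x w) = 2^-1 *: (((E : X -> R^o) \o
    (fun w => x + h *: w)) + ((E : X -> R^o) \o (fun w => x + - h *: w)))); last first.
  by apply/funext => w; rewrite /dimer_energy -scaleNr.
apply: is_diff_eq d _; apply/funext => z.
rewrite fctE /= fctE /= scaleNr /GRing.scale/= !dotp_lin; ring.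
Qed.

End DimerGradient.

(** * Taylor estimates near the saddle *)

Section SaddleEstimates.
Context {R : realType} {X : hilbertType R}.

Lemma segment_ball (p y x : X) (r c : R) : 0 <= c <= 1 ->
  `|x - p| <= r -> `|y - p| <= r -> `|y + c *: (x - y) - p| <= r.
Proof.
move=> /andP[c0 c1] xr yr.
have -> : y + c *: (x - y) - p = (1 - c) *: (y - p) + c *: (x - p) by vec_ring.
apply: (le_trans (ler_normD _ _)).
rewrite !normrZ ger0_norm ?subr_ge0// (ger0_norm c0).
have h1 : (1 - c) * `|y - p| <= (1 - c) * r by rewrite ler_wpM2l// subr_ge0.
have h2 : c * `|x - p| <= c * r by rewrite ler_wpM2l.
by have := lerD h1 h2; rewrite -mulrDl subrK mul1r.
Qed.

Variables (E : X -> R) (xs : X).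
Hypothesis E_C3 : is_Cn 3 (E : X -> R^o).
Let g := grad E.
Let A := hess E xs.

Lemma is_diff_grad_C3 x : is_diff x (E : X -> R^o) (dotp (g x)).
Proof. by have [D1 f1 _] := E_C3; exact: (is_diff_grad (f1 x)). Qed.

Lemma hess_sym w z : dotp (A w) z = dotp w (A z).
Proof.
have [D1 f1 [D2 f2 [D3 f3 _]]] := E_C3.
rewrite (dotpC w) !(hess_dotp _ f1 f2); apply: (hessian_symmetric f1 f2).
by move=> x; apply: differentiable_continuous; case: (f3 x).
Qed.

(** All three bounds come from the Lipschitz Hessian. The radius [r] stays free in the first and the
    third, so that their factor [L * r] shrinks with the region; the factor [|a|] in the second is
    what survives the division by [h] in the curvature. *)
Lemma grad_estimates : exists2 L : R, 0 < L & exists2 rho : R, 0 < rho &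
  [/\ forall r y z, r <= rho -> `|y - xs| <= r -> `|z - xs| <= r ->
        `|g y - g z - A (y - z)| <= L * r * `|y - z|,
      forall x y a, `|x - xs| + `|a| <= rho -> `|y - xs| + `|a| <= rho ->
        `|g (x + a) - g (x - a) - (g (y + a) - g (y - a))| <= 2 * L * `|a| * `|x - y| &
      forall r y z, r <= rho -> `|y - xs| <= r -> `|z - xs| <= r ->
        `|E y - E z - dotp (g z) (y - z) - 2^-1 * dotp (A (y - z)) (y - z)|
          <= L * r * `|y - z| ^+ 2].
Proof.
have [D1 f1 [D2 f2 [D3 f3 D3c]]] := E_C3.
have gD x u : dotp (g x) u = D1 x u.
  have := is_diff_unique (is_diff_grad_C3 x) (f1 x).
  by move=> /(congr1 (fun F => F u)).
have AD w z : dotp (A w) z = D2 xs w z := hess_dotp xs f1 f2 w z.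
have [L L0 [rho rho0 lip]] := hessian_locally_lipschitz f3 D3c xs.
exists L => //; exists rho => //.
have F1 r y z u : r <= rho -> `|y - xs| <= r -> `|z - xs| <= r ->
    `|dotp (g y) u - dotp (g z) u - dotp (A (y - z)) u| <= L * r * `|y - z| * `|u|.
  move=> rr yr zr.
  have [c c01 /= Hc] := mvt_line z (y - z) (fun q => is_diff_apply u (f2 q)).
  rewrite (addrC z) subrK in Hc; rewrite !gD Hc AD.
  have pr := segment_ball c01 yr zr.
  have xr : `|xs - xs| <= rho by rewrite subrr normr0 ltW.
  apply: (le_trans (lip _ _ _ _ (le_trans pr rr) xr)).
  apply: ler_wpM2r => //; apply: ler_wpM2r => //; apply: ler_wpM2l => //.
  exact: ltW.
split.
- move=> r y z rr yr zr.
  apply: norm_le_dotp => [|u].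
    by rewrite !mulr_ge0 ?(ltW L0)// (le_trans _ yr).
  rewrite dotpC !dotp_lin; apply: le_trans (ler_norm _) _; exact: F1.
- move=> x y a xr yr.
  apply: norm_le_dotp => [|u]; first by rewrite !mulr_ge0 ?(ltW L0).
  (* The mean value theorem moves the base point, not the shift: the derivative of [F] compares
     Hessians at points [2 * a] apart. *)
  pose F q := D1 (q + a) u - D1 (q + - a) u.
  have FD q : is_diff q (F : X -> R^o) (fun d => D2 (q + a) d u - D2 (q + - a) d u).
    have h b := is_diff_comp (is_diff_shift b q) (is_diff_apply u (f2 (q + b))).
    exact: (is_diffB (h a) (h (- a))).
  have [c c01 /= Hc] := mvt_line y (x - y) FD.
  rewrite (addrC y) subrK in Hc.
  have -> : dotp u (g (x + a) - g (x - a) - (g (y + a) - g (y - a))) = F x - F y.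
    by rewrite dotpC !dotp_lin !gD; rewrite /F.
  have br b : `|b| = `|a| -> `|y + c *: (x - y) + b - xs| <= rho.
    move=> ba; rewrite addrAC; apply: (le_trans (ler_normD _ _)); rewrite ba -lerBrDr.
    by apply: segment_ball => //; rewrite lerBrDr.
  rewrite Hc; apply: le_trans (ler_norm _) _.
  apply: (le_trans (lip _ _ _ _ (br a erefl) (br (- a) (normrN a)))).
  have -> : y + c *: (x - y) + a - (y + c *: (x - y) - a) = 2 *: a by vec_ring.
  by rewrite normrZ ger0_norm// mulrA (mulrC L 2).
- move=> r y z rr yr zr; set d := y - z.
  have r0 : 0 <= r := le_trans (normr_ge0 _) yr.
  set a := dotp (g z) d; set b := dotp (A d) d.
  (* With the quadratic model subtracted along the segment, a single mean value theorem reduces the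
     Taylor error to the gradient bound [F1]. *)
  have hq (t : R) : is_derive t 1 (fun s : R => s * a + s ^+ 2 * (2^-1 * b)) (a + t * b).
    apply: is_derive_eq; rewrite !scaler0 !add0r /GRing.scale/= !mulr1.
    by field.
  have he (t : R) : is_derive t 1 (fun s : R => E (z + s *: d)) (D1 (z + t *: d) d) :=
    is_derive_line (f1 (z + t *: d)).
  have hd t := is_deriveB (he t) (hq t).
  have cont : {within `[0, 1], continuous ((fun s : R => E (z + s *: d)) -
      (fun s : R => s * a + s ^+ 2 * (2^-1 * b)))}.
    by apply: derivable_within_continuous => s _; have [] := hd s.
  have [c] := MVT_segment ler01 (fun s _ => hd s) cont.
  rewrite in_itv/= !fctE scale0r addr0 scale1r /d (addrC z) subrK -/d => c01.
  rewrite subr0 mulr1 => Hc.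
  have -> : E y - E z - a - 2^-1 * b = D1 (z + c *: d) d - (a + c * b).
    by rewrite -Hc; ring.
  have pr := segment_ball c01 yr zr.
  have := F1 r (z + c *: d) z d rr pr zr.
  rewrite gD -/a (_ : z + c *: d - z = c *: d); last by vec_ring.
  have -> : dotp (A (c *: d)) d = c * b by rewrite linearZ/= dotpZl.
  rewrite -addrA -opprD => h; apply: (le_trans h).
  have /andP[c0 c1] := c01.
  rewrite normrZ (ger0_norm c0) expr2 -!(mulrA (L * r)).
  apply: ler_wpM2l; first by rewrite mulr_ge0// ltW.
  by rewrite ler_wpM2r ?ler_piMl.
Qed.

End SaddleEstimates.

(** * Contraction of the dimer steps *)

Section Rotation.
Context {R : realType}.
Implicit Types a b t : R.

Lemma lipschitz_itv (f df : R -> R) (t K a b : R) :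
  (forall x : R, is_derive x 1 f (df x)) -> (forall x, 0 <= x <= t -> `|df x| <= K) ->
  0 <= a <= t -> 0 <= b <= t -> `|f a - f b| <= K * `|a - b|.
Proof.
move=> fd dK; wlog ab : a b / b <= a.
  move=> H /[dup] a0 ? /[dup] b0 ?; have [ba|/ltW ab] := leP b a; first exact: H.
  by rewrite distrC (distrC a); exact: H.
move=> /andP[a0 at_] /andP[b0 bt].
have cont : {within `[b, a], continuous f}.
  by apply: derivable_within_continuous => s _; have [] := fd s.
have [c] := MVT_segment ab (fun s _ => fd s) cont.
rewrite in_itv/= => /andP[bc ca] ->; rewrite normrM ler_wpM2r//; apply: dK.
by rewrite (le_trans b0 bc) (le_trans ca at_).
Qed.

Lemma sin_norm_le t : 0 <= t -> `|sin t| <= t.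
Proof.
move=> t0.
have := @lipschitz_itv sin cos t 1 t 0 (fun x => is_derive_sin x).
rewrite sin0 !subr0 mul1r (ger0_norm t0); apply; rewrite ?lexx ?t0//.
by move=> x _; rewrite ler_norml cos_geN1 cos_le1.
Qed.

Lemma cos_lipschitz t a b : 0 <= a <= t -> 0 <= b <= t ->
  `|cos a - cos b| <= t * `|a - b|.
Proof.
apply: (@lipschitz_itv cos (fun x => - sin x)) => x /andP[x0 xt].
by rewrite normrN (le_trans (sin_norm_le x0)).
Qed.

Lemma one_sub_cos_le t a : 0 <= a <= t -> t <= 1 -> `|1 - cos a| <= t.
Proof.
move=> /andP[a0 at_] t1; have t0 := le_trans a0 at_.
have := @cos_lipschitz t 0 a; rewrite cos0 sub0r normrN (ger0_norm a0) lexx t0 a0 at_.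
move=> /(_ erefl erefl)/le_trans; apply.
by rewrite -[leRHS]mulr1 ler_wpM2l// (le_trans at_).
Qed.

Lemma sub_sin_lipschitz t a b : t <= 1 -> 0 <= a <= t -> 0 <= b <= t ->
  `|(a - sin a) - (b - sin b)| <= t * `|a - b|.
Proof.
move=> t1; apply: (@lipschitz_itv (fun x => x - sin x) (fun x => 1 - cos x)) => x xt.
exact: one_sub_cos_le.
Qed.

Context {X : hilbertType R}.
Implicit Types u v : X.

(** The exponential map of the unit sphere at [v] when [u] is tangent there; at [u = 0] the inverse
    of 0 being 0 gives [v]. *)
Definition geodesic v u : X := cos `|u| *: v + sin `|u| *: (`|u|^-1 *: u).

Lemma unit_dir u : `|u| *: (`|u|^-1 *: u) = u.
Proof.
have [->|u0] := eqVneq u 0; first by rewrite !scaler0.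
by rewrite scalerA divff ?scale1r// normr_eq0.
Qed.

Lemma unit_dir_le u : `| `|u|^-1 *: u| <= 1.
Proof.
have [->|u0] := eqVneq u 0; first by rewrite scaler0 normr0.
by rewrite normrZ normfV normr_id mulVf// normr_eq0.
Qed.

(** Normalisation is Lipschitz only with a constant like [1 / |v|]; the weight [|v|] keeps the bound
    valid at 0. In [geodesic_lipschitz] the factor [b - sin b <= t * b] provides that weight. *)
Lemma unit_dir_lipschitz u v : `|v| * `| `|u|^-1 *: u - `|v|^-1 *: v| <= 2 * `|u - v|.
Proof.
rewrite -{1}(normr_id v) -normrZ scalerBr unit_dir.
have -> : `|v| *: (`|u|^-1 *: u) - v = (`|v| - `|u|) *: (`|u|^-1 *: u) + (u - v).
  by rewrite scalerBl unit_dir addrA subrK.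
apply: (le_trans (ler_normD _ _)); rewrite normrZ mulr_natl mulr2n lerD2r.
apply: (@le_trans _ _ (`| `|v| - `|u| | * 1)).
  by rewrite ler_wpM2l// unit_dir_le.
by rewrite mulr1 distrC ler_dist_dist.
Qed.

(** For short steps the geodesic is [v + u] up to a remainder with Lipschitz constant of order [t].
    The 4 is 1 from the cosine, 1 from [a - sin a] and 2 from the change of unit direction. *)
Lemma geodesic_lipschitz (t : R) v v' u u' : `|v'| = 1 -> t <= 1 -> `|u| <= t -> `|u'| <= t ->
  `|geodesic v u - geodesic v' u' - (v - v') - (u - u')|
    <= t * `|v - v'| + 4 * t * `|u - u'|.
Proof.
move=> v'1 t1 ut u't; have t0 : 0 <= t := le_trans (normr_ge0 _) ut.
set e := `|u|^-1 *: u; set e' := `|u'|^-1 *: u'.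
set a := `|u|; set b := `|u'|.
have ab : `|a - b| <= `|u - u'| by exact: ler_dist_dist.
have ua : 0 <= a <= t by rewrite normr_ge0.
have ub : 0 <= b <= t by rewrite normr_ge0.
have hu : u = a *: e by rewrite unit_dir.
have hu' : u' = b *: e' by rewrite unit_dir.
have -> : geodesic v u - geodesic v' u' - (v - v') - (u - u') =
    - (1 - cos a) *: (v - v') + (cos a - cos b) *: v'
    + (- ((a - sin a) - (b - sin b)) *: e - (b - sin b) *: (e - e')).
  by rewrite {2}hu {2}hu' /geodesic -/a -/b -/e -/e'; vec_ring.
have h1 : `|- (1 - cos a) *: (v - v')| <= t * `|v - v'|.
  by rewrite normrZ normrN ler_wpM2r// one_sub_cos_le.
have h2 : `|(cos a - cos b) *: v'| <= t * `|u - u'|.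
  rewrite normrZ v'1 mulr1; apply: (le_trans (cos_lipschitz ua ub)).
  exact: ler_wpM2l.
have h3 : `|- ((a - sin a) - (b - sin b)) *: e| <= t * `|u - u'|.
  rewrite normrZ normrN -[leRHS]mulr1 ler_pM// ?unit_dir_le//.
  by apply: (le_trans (sub_sin_lipschitz t1 ua ub)); exact: ler_wpM2l.
have h4 : `|(b - sin b) *: (e - e')| <= 2 * t * `|u - u'|.
  have /andP[b0 bt] := ub.
  have := @sub_sin_lipschitz t b 0 t1 ub; rewrite lexx t0 sin0 !subr0 => /(_ erefl).
  rewrite (ger0_norm b0) => h.
  rewrite normrZ; apply: (@le_trans _ _ (t * b * `|e - e'|)); first by rewrite ler_wpM2r.
  rewrite (mulrC 2 t) -!mulrA ler_wpM2l//; exact: unit_dir_lipschitz.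
apply: (le_trans (ler_normD _ _)).
have := le_trans (ler_normD _ _) (lerD h1 h2).
have := le_trans (ler_normB _ _) (lerD h3 h4).
move=> k1 k2; apply: (le_trans (lerD k2 k1)).
by rewrite le_eqVlt; apply/orP; left; apply/eqP; ring.
Qed.

End Rotation.

Section NormBounds.
Context {R : realType} {X : hilbertType R}.
Implicit Types x y u v d : X.

Lemma normD_le x y (a b : R) : `|x| <= a -> `|y| <= b -> `|x + y| <= a + b.
Proof. by move=> xa yb; apply: (le_trans (ler_normD _ _)); exact: lerD. Qed.

Lemma normB_le x y (a b : R) : `|x| <= a -> `|y| <= b -> `|x - y| <= a + b.
Proof. by move=> xa yb; apply: (le_trans (ler_normB _ _)); exact: lerD. Qed.

Lemma dotp_norm_le u x (a b : R) : `|u| <= a -> `|x| <= b -> `|dotp u x| <= a * b.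
Proof. by move=> ua xb; apply: (le_trans (cauchy_schwarz _ _)); exact: ler_pM. Qed.

Lemma normZ_le (k : R) y (a b : R) : `|k| <= a -> `|y| <= b -> `|k *: y| <= a * b.
Proof. by move=> ka yb; rewrite normrZ; exact: ler_pM. Qed.

Lemma absD_le (x y a b : R) : `|x| <= a -> `|y| <= b -> `|x + y| <= a + b.
Proof. by move=> xa yb; apply: (le_trans (ler_normD _ _)); exact: lerD. Qed.

Lemma absM_le (x y a b : R) : `|x| <= a -> `|y| <= b -> `|x * y| <= a * b.
Proof. by move=> xa yb; rewrite normrM; exact: ler_pM. Qed.

(* In the expansion of [`|d - a *: Td| ^+ 2] the cross term gains [2 a c `|d| ^+ 2],
   while [a * K ^+ 2 <= c] keeps the quadratic term below half of that gain. *)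
Lemma coercive_step d Td (a c K : R) : 0 <= a -> 0 <= K -> 0 <= c ->
  c * `|d| ^+ 2 <= dotp Td d -> `|Td| <= K * `|d| -> a * K ^+ 2 <= c -> a * c <= 1 ->
  `|d - a *: Td| <= (1 - a * c / 2) * `|d|.
Proof.
move=> a0 K0 c0 coer bd aK ac.
have q0 : 0 <= 1 - a * c / 2 by nra.
rewrite -(@ler_pXn2r _ 2) ?nnegrE ?mulr_ge0//.
rewrite normB_sqr dotpZr normrZ (ger0_norm a0) (dotpC d) exprMn.
have bd2 : `|Td| ^+ 2 <= K ^+ 2 * `|d| ^+ 2.
  by rewrite -exprMn ler_pXn2r ?nnegrE ?mulr_ge0.
have n0 : 0 <= `|d| ^+ 2 by rewrite exprn_ge0.
have h1 : a * (c * `|d| ^+ 2) <= a * dotp Td d by rewrite ler_wpM2l.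
have h2 : a ^+ 2 * `|Td| ^+ 2 <= a * c * `|d| ^+ 2.
  apply: (@le_trans _ _ (a ^+ 2 * (K ^+ 2 * `|d| ^+ 2))); first by rewrite ler_wpM2l// exprn_ge0.
  have -> : a ^+ 2 * (K ^+ 2 * `|d| ^+ 2) = a * (a * K ^+ 2) * `|d| ^+ 2 by ring.
  by rewrite ler_wpM2r// ler_wpM2l.
have h3 : 0 <= (a * c / 2) ^+ 2 * `|d| ^+ 2 by rewrite mulr_ge0// sqr_ge0.
have -> : ((1 - a * c / 2) * `|d|) ^+ 2
  = `|d| ^+ 2 - a * c * `|d| ^+ 2 + (a * c / 2) ^+ 2 * `|d| ^+ 2 by field.
rewrite mulrA (mulrC 2) -mulrA.
by move: (dotp Td d) (`|Td| ^+ 2) (`|d| ^+ 2) h1 h2 h3 {bd2 coer n0} => p q r; lra.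
Qed.

End NormBounds.

(** * Contraction estimates around the linearised saddle *)

Section LocalModel.
Context {R : realType} {X : hilbertType R}.
Variables (g : X -> X) (A : 'L(X, X)) (xs vs : X) (ls mu L rho0 M : R).
Hypothesis A_sym : forall w z, dotp (A w) z = dotp w (A z).
Hypothesis A_vs : A vs = ls *: vs.
Hypothesis vs1 : `|vs| = 1.
Hypothesis ls_lt0 : ls < 0.
Hypothesis mu_gt0 : 0 < mu.
Hypothesis A_coercive : forall w, dotp vs w = 0 -> mu * `|w| ^+ 2 <= dotp (A w) w.
Hypothesis L_gt0 : 0 < L.
Hypothesis M_gt0 : 0 < M.
Hypothesis rho0_gt0 : 0 < rho0.
Hypothesis A_le : forall w, `|A w| <= M * `|w|.
Hypothesis g_xs : g xs = 0.
Hypothesis g_lin : forall r y z, r <= rho0 -> `|y - xs| <= r -> `|z - xs| <= r ->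
  `|g y - g z - A (y - z)| <= L * r * `|y - z|.
Hypothesis g_diff2 : forall x y a, `|x - xs| + `|a| <= rho0 -> `|y - xs| + `|a| <= rho0 ->
  `|g (x + a) - g (x - a) - (g (y + a) - g (y - a))| <= 2 * L * `|a| * `|x - y|.

Let kappa := mu - ls.
Let kappa_gt0 : 0 < kappa.
Proof. by rewrite subr_gt0 (lt_trans ls_lt0). Qed.

Definition mean_grad (h : R) x v := 2^-1 *: (g (x + h *: v) + g (x - h *: v)).
Definition curv (h : R) x v := (2 * h)^-1 *: (g (x + h *: v) - g (x - h *: v)).
Definition rotation_dir h x v := - (curv h x v - dotp v (curv h x v) *: v).
Definition xstep (h a : R) x v :=
  x - a *: (mean_grad h x v - 2 *: (dotp v (mean_grad h x v) *: v)).
Definition vstep (h b : R) x v := geodesic v (b *: rotation_dir h x v).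

Definition region (rho : R) x v := [/\ `|x - xs| <= rho, `|v - vs| <= rho & `|v| = 1].

(* Linearisations at the saddle of the (negated) x- and v-directions. The rank-one
   term in [T] makes it coercive and costs only [O(rho) `|w|] when [w] is a
   difference of unit vectors near [vs]. *)
Let P d := A d - 2 *: (dotp vs (A d) *: vs).
Let T w := A w - ls *: w + (kappa * dotp vs w) *: vs.

Let ls_le : `|ls| <= M.
Proof. by have := A_le vs; rewrite A_vs normrZ vs1 !mulr1. Qed.

Let A_dot_vs w : dotp vs (A w) = ls * dotp vs w.
Proof. by rewrite -A_sym A_vs dotpZl. Qed.

(** Here [q] is the squared norm of the part of [d] orthogonal to [vs]; as [vs] is an eigenvector,
    the quadratic form has no cross term. *)
Lemma A_decomp d : exists2 q : R, 0 <= q & 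
  `|d| ^+ 2 = q + (dotp vs d) ^+ 2 /\ 
  mu * q + ls * (dotp vs d) ^+ 2 <= dotp (A d) d.
Proof.
set a := dotp vs d.
have [w dE vw] : exists2 w, d = w + a *: vs & dotp vs w = 0.
  by exists (d - a *: vs); rewrite ?subrK// !dotp_lin dotp_norm vs1 -/a; ring.
exists (`|w| ^+ 2); first by rewrite exprn_ge0.
have wv : dotp w vs = 0 by rewrite dotpC.
have := A_coercive vw => coer; split.
  by rewrite {1}dE normD_sqr dotpZr wv normrZ vs1 mulr1 real_normK ?num_real//; ring.
have -> : dotp (A d) d = dotp (A w) w + ls * a ^+ 2; last by rewrite lerD2r.
have AE : A d = A w + a *: (ls *: vs) by rewrite -A_vs -linearZ -linearD -dE.
rewrite AE [X in dotp _ X]dE !dotp_lin vw dotp_norm vs1.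
by rewrite (dotpC (A w) vs) A_dot_vs vw; ring.
Qed.

(** The reflection turns the eigenvalue [ls < 0] into [- ls] and leaves the form on the complement
    of [vs] unchanged. *)
Lemma P_coercive (c : R) d : c <= mu -> c <= - ls -> c * `|d| ^+ 2 <= dotp (P d) d.
Proof.
move=> cm cl; have [q q0 [nd coer]] := A_decomp d.
rewrite /P !dotp_lin A_dot_vs nd; move: (dotp vs d) (dotp (A d) d) coer => a t coer.
have : 0 <= a ^+ 2 by exact: sqr_ge0.
move: (ls) cl coer => l cl coer; nra.
Qed.

Lemma P_le d : `|P d| <= 3 * M * `|d|.
Proof.
have h : `|2 *: (dotp vs (A d) *: vs)| <= 2 * (1 * (M * `|d|) * 1).
  apply: normZ_le; first by rewrite ger0_norm.
  by apply: normZ_le; rewrite ?vs1//; apply: dotp_norm_le; rewrite ?vs1.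
by apply: (le_trans (normB_le (A_le d) h)); lra.
Qed.

(** On the complement of [vs] the form of [A - ls] is at least [mu - ls]; along [vs] it vanishes and
    the rank-one term supplies the same constant. *)
Lemma T_coercive w : kappa * `|w| ^+ 2 <= dotp (T w) w.
Proof.
have [q q0 [nd coer]] := A_decomp w.
rewrite /T !dotp_lin dotp_norm nd; move: (dotp vs w) (dotp (A w) w) coer => a t coer.
by rewrite /kappa; lra.
Qed.

Lemma T_le w : `|T w| <= (2 * M + kappa) * `|w|.
Proof.
have h1 : `|ls *: w| <= M * `|w| by apply: normZ_le.
have h2 : `|(kappa * dotp vs w) *: vs| <= kappa * (1 * `|w|) * 1.
  apply: normZ_le; rewrite ?vs1//; apply: absM_le; first by rewrite gtr0_norm.
  by apply: dotp_norm_le; rewrite ?vs1.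
by apply: (le_trans (normD_le (normB_le (A_le w) h1) h2)); lra.
Qed.

Section Region.
Variables (rho h : R).
Hypothesis h_gt0 : 0 < h.
Hypothesis h_le : h <= rho.
Hypothesis rho_le1 : rho <= 1.
Hypothesis rho_le0 : 2 * rho <= rho0.

Let rho_gt0 : 0 < rho. Proof. exact: lt_le_trans h_gt0 h_le. Qed.

Let hv (v : X) : `|v| = 1 -> `|h *: v| = h.
Proof. by move=> v1; rewrite normrZ v1 mulr1 gtr0_norm. Qed.

Let shiftD r x v : `|x - xs| <= r -> `|v| = 1 -> `|x + h *: v - xs| <= r + h.
Proof. by move=> xr v1; rewrite addrAC; apply: normD_le => //; rewrite hv. Qed.

Let shiftB r x v : `|x - xs| <= r -> `|v| = 1 -> `|x - h *: v - xs| <= r + h.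
Proof. by move=> xr v1; rewrite addrAC; apply: normB_le => //; rewrite hv. Qed.

Let shiftD2 x v : `|x - xs| <= rho -> `|v| = 1 -> `|x + h *: v - xs| <= 2 * rho.
Proof. by move=> xr v1; apply: (le_trans (shiftD xr v1)); have := h_le; lra. Qed.

Let shiftB2 x v : `|x - xs| <= rho -> `|v| = 1 -> `|x - h *: v - xs| <= 2 * rho.
Proof. by move=> xr v1; apply: (le_trans (shiftB xr v1)); have := h_le; lra. Qed.

(** The two linear contributions of [h *: (v - v')] have opposite signs and cancel, so [v] enters
    only through the error of order [rho]. *)
Lemma mean_grad_lin x v x' v' : region rho x v -> region rho x' v' ->
  `|mean_grad h x v - mean_grad h x' v' - A (x - x')|
    <= 2 * L * rho * (`|x - x'| + `|v - v'|).
Proof.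
move=> [xr _ v1] [x'r _ v'1].
have bd y y' d : `|y - xs| <= 2 * rho -> `|y' - xs| <= 2 * rho -> y - y' = d ->
    `|d| <= `|x - x'| + `|v - v'| ->
    `|g y - g y' - A d| <= L * (2 * rho) * (`|x - x'| + `|v - v'|).
  move=> yr y'r <- dd; apply: (le_trans (g_lin rho_le0 yr y'r)).
  by rewrite ler_wpM2l// !mulr_ge0// ltW.
have hvv : `|h *: (v - v')| <= `|v - v'|.
  by rewrite normrZ gtr0_norm// ler_piMl// (le_trans h_le).
have h1 := bd _ _ ((x - x') + h *: (v - v')) (shiftD2 xr v1) (shiftD2 x'r v'1).
have h2 := bd _ _ ((x - x') - h *: (v - v')) (shiftB2 xr v1) (shiftB2 x'r v'1).
have {}h1 := h1 ltac:(vec_ring) (normD_le (lexx _) hvv).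
have {}h2 := h2 ltac:(vec_ring) (normB_le (lexx _) hvv).
rewrite linearD in h1; rewrite linearB in h2.
have -> : mean_grad h x v - mean_grad h x' v' - A (x - x') =
  2^-1 *: ((g (x + h *: v) - g (x' + h *: v') - (A (x - x') + A (h *: (v - v')))) +
           (g (x - h *: v) - g (x' - h *: v') - (A (x - x') - A (h *: (v - v'))))).
  by rewrite /mean_grad; apply: dotp_ext => z; rewrite !dotp_lin; field.
rewrite normrZ ger0_norm//.
by have := normD_le h1 h2; lra.
Qed.

Lemma mean_grad_le x v : region rho x v -> `|mean_grad h x v| <= 2 * (M + 2 * L) * rho.
Proof.
move=> [xr _ v1].
have bd y : `|y - xs| <= 2 * rho -> `|g y| <= 2 * (M + 2 * L) * rho.
  move=> yr; have xx : `|xs - xs| <= 2 * rho by rewrite subrr normr0 mulr_ge0// ltW.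
  have := g_lin rho_le0 yr xx; rewrite g_xs subr0 => h1.
  have -> : g y = (g y - A (y - xs)) + A (y - xs) by rewrite subrK.
  apply: (le_trans (normD_le h1 (A_le _))); rewrite -mulrDl.
  have h3 : (L * (2 * rho) + M) * `|y - xs| <= (L * (2 * rho) + M) * (2 * rho).
    by rewrite ler_wpM2l// addr_ge0 ?(ltW M_gt0)// !mulr_ge0// ltW.
  apply: (le_trans h3).
  have : L * rho * rho <= L * rho * 1 by rewrite ler_wpM2l// mulr_ge0// ltW.
  lra.
rewrite /mean_grad normrZ ger0_norm//.
by have := normD_le (bd _ (shiftD2 xr v1)) (bd _ (shiftB2 xr v1)); lra.
Qed.

Lemma curv_lin x v x' v' : region rho x v -> region rho x' v' ->
  `|curv h x v - curv h x' v' - A (v - v')| <= 2 * L * rho * `|v - v'| + L * `|x - x'|.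
Proof.
move=> [xr _ v1] [x'r _ v'1].
have bd y y' d : `|y - xs| <= 2 * rho -> `|y' - xs| <= 2 * rho -> y - y' = d ->
    `|d| <= h * `|v - v'| ->
    `|g y - g y' - A d| <= L * (2 * rho) * (h * `|v - v'|).
  move=> yr y'r <- dd; apply: (le_trans (g_lin rho_le0 yr y'r)).
  by rewrite ler_wpM2l// !mulr_ge0// ltW.
have h1 := bd _ _ (h *: (v - v')) (shiftD2 xr v1) (shiftD2 xr v'1).
have h2 := bd _ _ (- (h *: (v - v'))) (shiftB2 xr v1) (shiftB2 xr v'1).
have {}h1 := h1 ltac:(vec_ring).
have {}h2 := h2 ltac:(vec_ring).
rewrite normrZ gtr0_norm// in h1; rewrite normrN normrZ gtr0_norm// in h2.
have {}h1 := h1 (lexx _); have {}h2 := h2 (lexx _).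
have AN : A (- (h *: (v - v'))) = - (h *: A (v - v')) by rewrite -!scaleNr linearZ.
rewrite AN in h2; rewrite linearZ/= in h1.
(* The change from [(x, v)] to [(x', v')] goes through [(x, v')]: turning [v] costs [h * |v - v'|]
   and moving [x] costs [h * |x - x'|], so the division by [2 * h] is harmless. *)
have h3 : `|g (x + h *: v') - g (x - h *: v') - (g (x' + h *: v') - g (x' - h *: v'))|
    <= 2 * L * h * `|x - x'|.
  by rewrite -[X in _ <= 2 * L * X * _](hv v'1); apply: g_diff2; rewrite hv//; have := h_le; have := rho_le0; lra.
have -> : curv h x v - curv h x' v' - A (v - v') = (2 * h)^-1 *:
   (((g (x + h *: v) - g (x + h *: v') - h *: A (v - v')) -
    (g (x - h *: v) - g (x - h *: v') - - (h *: A (v - v')))) +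
    (g (x + h *: v') - g (x - h *: v') - (g (x' + h *: v') - g (x' - h *: v')))).
  have hn : h != 0 by rewrite gt_eqF.
  by rewrite /curv; apply: dotp_ext => z; rewrite !dotp_lin; field.
have p0 : 0 < (2 * h)^-1 by rewrite invr_gt0 mulr_gt0.
rewrite normrZ (gtr0_norm p0) mulrC ler_pdivrMr ?mulr_gt0//.
by apply: (le_trans (normD_le (normB_le h1 h2) h3)); lra.
Qed.

Lemma curv_approx x v r : `|x - xs| <= r -> r + h <= rho0 -> `|v| = 1 ->
  `|curv h x v - A v| <= L * (r + h).
Proof.
move=> xr rr v1.
have := g_lin rr (shiftD xr v1) (shiftB xr v1).
have -> : x + h *: v - (x - h *: v) = (2 * h) *: v by vec_ring.
have h2 : 0 < 2 * h by rewrite mulr_gt0.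
have -> : A ((2 * h) *: v) = (2 * h) *: A v by rewrite linearZ.
rewrite normrZ v1 mulr1 gtr0_norm// => H.
have -> : curv h x v - A v =
    (2 * h)^-1 *: (g (x + h *: v) - g (x - h *: v) - (2 * h) *: A v).
  by rewrite /curv [RHS]scalerBr scalerA mulVf ?scale1r// gt_eqF.
by rewrite normrZ normfV (gtr0_norm h2) mulrC ler_pdivrMr.
Qed.

Lemma proj_le (v a : X) : `|v| = 1 -> `|a - dotp v a *: v| <= `|a|.
Proof.
move=> v1; rewrite -(@ler_pXn2r _ 2) ?nnegrE//.
rewrite normB_sqr dotpZr normrZ v1 mulr1 real_normK ?num_real// (dotpC a).
by have := sqr_ge0 (dotp v a); lra.
Qed.

(** Projecting away [v] ignores any multiple of [v], so [l] may be the approximate eigenvalue. *)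
Lemma rotation_dir_le x v (l : R) : `|v| = 1 ->
  `|rotation_dir h x v| <= `|curv h x v - l *: v|.
Proof.
move=> v1; rewrite /rotation_dir normrN; move: (curv h x v) => N.
apply: le_trans (proj_le (N - l *: v) v1).
rewrite !dotp_lin dotp_norm v1 (_ : N - dotp v N *: v = N - l *: v - (dotp v N + - (l * 1 ^+ 2)) *: v)//.
vec_ring.
Qed.

Lemma curv_near x v : region rho x v -> `|curv h x v - ls *: vs| <= (2 * L + M) * rho.
Proof.
move=> [xr vr v1].
have rr : rho + h <= rho0 by have := h_le; have := rho_le0; lra.
have h1 := curv_approx xr rr v1.
have h2 : `|A v - ls *: vs| <= M * rho.
  by rewrite -A_vs -linearB; apply: (le_trans (A_le _)); rewrite ler_pM2l.
have -> : curv h x v - ls *: vs = (curv h x v - A v) + (A v - ls *: vs) by rewrite addrA subrK.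
apply: (le_trans (normD_le h1 h2)).
have : L * (rho + h) <= L * (2 * rho) by rewrite ler_pM2l//; have := h_le; lra.
lra.
Qed.

Lemma rotation_dir_small x v : region rho x v ->
  `|rotation_dir h x v| <= (2 * L + 2 * M) * rho.
Proof.
move=> xv; have [_ vr v1] := xv.
apply: (le_trans (rotation_dir_le x ls v1)).
have -> : curv h x v - ls *: v = (curv h x v - ls *: vs) - ls *: (v - vs) by vec_ring.
have h1 : `|ls *: (v - vs)| <= M * rho by apply: normZ_le.
by apply: (le_trans (normB_le (curv_near xv) h1)); lra.
Qed.

Lemma xstep_lipschitz (c a : R) x v x' v' : region rho x v -> region rho x' v' ->
  0 <= a -> 0 <= c -> c <= mu -> c <= - ls -> a * (3 * M) ^+ 2 <= c -> a * c <= 1 ->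
  `|xstep h a x v - xstep h a x' v'| <= (1 - a * c / 2) * `|x - x'|
     + a * ((22 * L + 12 * M) * rho * (`|x - x'| + `|v - v'|)).
Proof.
move=> xv x'v' a0 c0 cmu cls aM ac.
have [xr vr v1] := xv; have [x'r v'r v'1] := x'v'.
have hd := mean_grad_lin xv x'v'; have hG := mean_grad_le x'v'.
have hP := coercive_step a0 (mulr_ge0 (ler0n _ 3) (ltW M_gt0)) c0
  (P_coercive (x - x') cmu cls) (P_le _) aM ac.
have ler0 : 0 <= L * rho * `|x - x'| by rewrite !mulr_ge0// ltW.
have ler1 : 0 <= M * rho * `|x - x'| by rewrite !mulr_ge0// ltW.
rewrite /xstep; move: hd hG hP; rewrite /P.
have := A_le (x - x').
move: (mean_grad h x v) (mean_grad h x' v') (A (x - x')) => G G' Ad hA hd hG hP.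
set e := G - G' - Ad in hd.
have ne : 0 <= `|e| by [].
(* The excess of the reflected term over [dotp vs Ad *: vs]: one summand from the nonlinearity [e],
   two from replacing [v] by [vs], and two from turning [v] to [v'], which multiply a gradient of
   order [rho]. *)
pose S := dotp v e *: v + dotp (v - vs) Ad *: v + dotp vs Ad *: (v - vs)
  + dotp (v - v') G' *: v + dotp v' G' *: (v - v').
have -> : x - a *: (G - 2 *: (dotp v G *: v)) - (x' - a *: (G' - 2 *: (dotp v' G' *: v')))
  = (x - x' - a *: (Ad - 2 *: (dotp vs Ad *: vs))) - a *: (e - 2 *: S).
  by rewrite /S /e; vec_ring.
have hS : `|S| <= 1 * `|e| * 1 + rho * (M * `|x - x'|) * 1 + 1 * (M * `|x - x'|) * rho
   + `|v - v'| * (2 * (M + 2 * L) * rho) * 1 + 1 * (2 * (M + 2 * L) * rho) * `|v - v'|.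
  rewrite /S; do ?[apply: normD_le]; apply: normZ_le; rewrite ?v1//;
    apply: dotp_norm_le; by rewrite ?v1 ?vs1 ?v'1.
apply: (normB_le hP); rewrite normrZ (ger0_norm a0) ler_wpM2l//.
have h2S : `|2 *: S| <= 2 * `|S| by rewrite normrZ ger0_norm.
apply: (le_trans (normB_le (lexx _) h2S)).
have h3 : 0 <= M * rho * `|v - v'| by rewrite !mulr_ge0// ltW.
by move: hd hS ler0 ler1 h3; move: (`|e|) (`|S|) (`|x - x'|) (`|v - v'|) => *; lra.
Qed.

(** For unit vectors [v - v'] is orthogonal to [v + v'], and the midpoint of [v] and [v'] is within
    [rho] of [vs]. *)
Lemma unit_dotB_le v v' : `|v| = 1 -> `|v'| = 1 -> `|v - vs| <= rho -> `|v' - vs| <= rho ->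
  `|dotp vs (v - v')| <= rho * `|v - v'|.
Proof.
move=> v1 v'1 vr v'r.
have -> : dotp vs (v - v') = dotp (- (2^-1 *: ((v - vs) + (v' - vs)))) (v - v').
  by rewrite !dotp_lin !dotp_norm v1 v'1 (dotpC v' v); field.
apply: dotp_norm_le => //; rewrite normrN normrZ ger0_norm//.
by have := normD_le vr v'r; lra.
Qed.

Lemma rotation_dir_lin x v x' v' : region rho x v -> region rho x' v' ->
  `|rotation_dir h x v - rotation_dir h x' v' + T (v - v')|
    <= (8 * L + 6 * M + kappa) * rho * `|v - v'| + 2 * L * `|x - x'|.
Proof.
move=> xv x'v'; have [xr vr v1] := xv; have [x'r v'r v'1] := x'v'.
have hd := curv_lin xv x'v'; have hN := curv_near xv; have hN' := curv_near x'v'.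
have hw := unit_dotB_le v1 v'1 vr v'r.
have Aw := A_dot_vs (v - v').
rewrite /rotation_dir /T; move: hd hN hN' Aw (A_le (v - v')).
set w := v - v'; move: (curv h x v) (curv h x' v') (A w) => N N' B hd hN hN' Aw hA.
set e := N - N' - B in hd.
(* [p] is the deviation of the Rayleigh quotient [dotp v N] from [ls]; [q] is its change between the
   two points, split so that every summand contains [w] or [e]. *)
pose p := dotp v (N - ls *: vs) + ls * dotp v (vs - v).
pose q := dotp w (N' - ls *: vs) + ls * dotp vs w + dotp v e + dotp (v - vs) B + ls * dotp vs w.
have hp : `|p| <= 1 * ((2 * L + M) * rho) + M * (1 * rho).
  apply: absD_le; first by apply: dotp_norm_le; rewrite ?v1.
  by apply: absM_le => //; apply: dotp_norm_le; rewrite ?v1 1?distrC.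
have hq : `|q| <= `|w| * ((2 * L + M) * rho) + M * (rho * `|w|) + 1 * `|e|
    + rho * (M * `|w|) + M * (rho * `|w|).
  by rewrite /q; do ?[apply: absD_le]; do ?[by apply: dotp_norm_le; rewrite ?v1]; exact: absM_le.
have pE : dotp v N = p + ls.
  by rewrite /p !dotp_lin dotp_norm v1; ring.
have qE : dotp v N - dotp v' N' = q.
  have eB : dotp (v - vs) B = dotp v B - ls * dotp vs w by rewrite dotpDl dotpNl Aw.
  by rewrite /q eB /e /w !dotp_lin (dotpC vs v) (dotpC vs v'); ring.
have -> : - (N - dotp v N *: v) - - (N' - dotp v' N' *: v') +
    (B - ls *: w + (kappa * dotp vs w) *: vs)
  = - e + p *: w + q *: v' + (kappa * dotp vs w) *: vs.
  by rewrite -qE pE /e /w; vec_ring.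
have h1 : `|- e| <= `|e| by rewrite normrN.
have h2 := normZ_le hp (lexx `|w|).
have h3 : `|q *: v'| <= (`|w| * ((2 * L + M) * rho) + M * (rho * `|w|) + 1 * `|e|
    + rho * (M * `|w|) + M * (rho * `|w|)) * 1 by apply: normZ_le; rewrite ?v'1.
have h4 : `|(kappa * dotp vs w) *: vs| <= kappa * (rho * `|w|) * 1.
  by apply: normZ_le; rewrite ?vs1//; apply: absM_le => //; rewrite gtr0_norm.
apply: (le_trans (normD_le (normD_le (normD_le h1 h2) h3) h4)).
by move: hd; move: (`|e|) (`|w|) (`|x - x'|) => *; lra.
Qed.

Lemma vstep_lipschitz (c b : R) x v x' v' : region rho x v -> region rho x' v' ->
  0 <= b -> b <= 1 -> 0 <= c -> c <= kappa -> b * (2 * M + kappa) ^+ 2 <= c -> b * c <= 1 ->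
  (2 * L + 2 * M) * rho <= 1 ->
  `|vstep h b x v - vstep h b x' v'| <= (1 - b * c / 2) * `|v - v'|
    + b * (((2 * L + 2 * M) * (1 + 4 * (10 * L + 8 * M + 2 * kappa)) + (8 * L + 6 * M + kappa))
             * rho * `|v - v'|
           + (2 * L + 4 * (10 * L + 8 * M + 2 * kappa)) * `|x - x'|).
Proof.
move=> xv x'v' b0 b1 c0 ck bK bc K3.
have [xr vr v1] := xv; have [x'r v'r v'1] := x'v'.
have s1 := rotation_dir_small xv; have s2 := rotation_dir_small x'v'.
have hs := rotation_dir_lin xv x'v'.
have hT := T_le (v - v').
have tc := T_coercive (v - v').
have {}tc : c * `|v - v'| ^+ 2 <= dotp (T (v - v')) (v - v').
  by apply: le_trans tc; rewrite ler_wpM2r// exprn_ge0.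
have K0 : 0 <= 2 * M + kappa by rewrite addr_ge0 ?(ltW kappa_gt0)// mulr_ge0// ltW.
have hstep := coercive_step b0 K0 c0 tc hT bK bc.
rewrite /vstep; move: s1 s2 hs hT hstep {tc}.
move: (rotation_dir h x v) (rotation_dir h x' v') => s s' s1 s2 hs hT hstep.
(* Bounds both tangent steps, so the geodesic remainder carries the factor [b * rho]. *)
pose t := b * ((2 * L + 2 * M) * rho).
have t1 : t <= 1 by rewrite /t mulr_ile1// mulr_ge0 ?(ltW rho_gt0)// addr_ge0// mulr_ge0// ltW.
have bs1 : `|b *: s| <= t by rewrite normrZ (ger0_norm b0) ler_wpM2l.
have bs2 : `|b *: s'| <= t by rewrite normrZ (ger0_norm b0) ler_wpM2l.
have hg := geodesic_lipschitz v v'1 t1 bs1 bs2.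
set D := geodesic v _ - geodesic v' _ in hg *.
have -> : D = (D - (v - v') - (b *: s - b *: s')) + (v - v' - b *: T (v - v'))
     + b *: (s - s' + T (v - v')) by vec_ring.
have hb : `|b *: (s - s' + T (v - v'))| <= b * ((8 * L + 6 * M + kappa) * rho * `|v - v'|
   + 2 * L * `|x - x'|) by rewrite normrZ (ger0_norm b0) ler_wpM2l.
apply: (le_trans (normD_le (normD_le hg hstep) hb)).
have hss : `|s - s'| <= (10 * L + 8 * M + 2 * kappa) * (`|v - v'| + `|x - x'|).
  have -> : s - s' = (s - s' + T (v - v')) - T (v - v') by rewrite addrK.
  apply: (le_trans (normB_le hs hT)).
  have : (8 * L + 6 * M + kappa) * rho * `|v - v'| <= (8 * L + 6 * M + kappa) * 1 * `|v - v'|.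
    rewrite ler_wpM2r// ler_wpM2l//.
    by have := L_gt0; have := M_gt0; have := kappa_gt0; lra.
  have := mulr_ge0 (ltW L_gt0) (normr_ge0 (v - v')).
  have := mulr_ge0 (ltW L_gt0) (normr_ge0 (x - x')).
  have := mulr_ge0 (ltW M_gt0) (normr_ge0 (x - x')).
  have := mulr_ge0 (ltW kappa_gt0) (normr_ge0 (x - x')).
  lra.
rewrite -scalerBr normrZ (ger0_norm b0) /t.
set K3' := (2 * L + 2 * M) in K3 *; set K6 := (8 * L + 6 * M + kappa).
set K7 := (10 * L + 8 * M + 2 * kappa) in hss *.
set ev := `|v - v'| in hss *; set ex := `|x - x'| in hss *; set n := `|s - s'| in hss *.
have K3p : 0 <= K3' by rewrite /K3' addr_ge0// mulr_ge0// ltW.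
have k7 : 0 <= K7 by rewrite /K7; have := L_gt0; have := M_gt0; have := kappa_gt0; lra.
have q0 : 0 <= K3' * rho by rewrite mulr_ge0// ltW.
have e1 : b * n <= K7 * (ev + ex).
  by apply: le_trans hss; rewrite ler_piMl// /n.
have e2 : K3' * rho * (b * n) <= K3' * rho * (K7 * (ev + ex)) by rewrite ler_wpM2l.
have e3 : K3' * rho * (K7 * ex) <= 1 * (K7 * ex) by rewrite ler_wpM2r// mulr_ge0// /ex.
have e4 : b * (K3' * rho * (b * n)) <= b * (K3' * rho * K7 * ev + K7 * ex).
  by rewrite ler_wpM2l//; lra.
by clearbody K3' K6 K7 ev ex n; lra.
Qed.

End Region.

(** The quantifier order matters: [eps] may be chosen after [K] and paid for by the radius [rho],
    while the rates and the step bounds stay fixed. *)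
Lemma local_contraction : exists c K abar bbar : R,
  [/\ 0 < c, 0 < K, 0 < abar & 0 < bbar] /\ [/\ abar * c <= 1, bbar * c <= 1 & bbar <= 1] /\
  forall eps B : R, 0 < eps -> 0 < B -> exists2 rho : R, 0 < rho <= B &
  forall h x v x' v', 0 < h -> h <= rho -> region rho x v -> region rho x' v' ->
    (forall a, 0 <= a -> a <= abar -> `|xstep h a x v - xstep h a x' v'|
       <= (1 - a * c) * `|x - x'| + a * eps * `|v - v'|) /\
    (forall b, 0 <= b -> b <= bbar -> `|vstep h b x v - vstep h b x' v'|
       <= (1 - b * c) * `|v - v'| + b * K * `|x - x'|).
Proof.
have [c0 c00 [c0m c0l]] : exists2 c0, 0 < c0 & c0 <= mu /\ c0 <= - ls.
  exists (Num.min mu (- ls)); first by rewrite lt_min mu_gt0 oppr_gt0.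
  by rewrite !ge_min !lexx orbT.
have c0k : c0 <= kappa by rewrite /kappa; have := ls_lt0; lra.
have kp := kappa_gt0.
have M2 : 0 < (3 * M) ^+ 2 by rewrite exprn_gt0// mulr_gt0.
have K2 : 0 < (2 * M + kappa) ^+ 2 by rewrite exprn_gt0// addr_gt0// mulr_gt0.
(* The two conditions of [coercive_step], with the bound [3 * M] on [P]; [bbar] has the same two for
   [T], and the cap 1. *)
pose abar := Num.min c0^-1 (c0 / (3 * M) ^+ 2).
pose bbar := Num.min 1 (Num.min c0^-1 (c0 / (2 * M + kappa) ^+ 2)).
have ab0 : 0 < abar by rewrite lt_min invr_gt0 c00 divr_gt0.
have bb0 : 0 < bbar by rewrite !lt_min invr_gt0 c00 ltr01 divr_gt0.
have ab1 a : a <= abar -> a * c0 <= 1 /\ a * (3 * M) ^+ 2 <= c0.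
  rewrite le_min => /andP[h1 h2].
  by split; rewrite -ler_pdivlMr// div1r.
have bb1 b : b <= bbar -> [/\ b <= 1, b * c0 <= 1 & b * (2 * M + kappa) ^+ 2 <= c0].
  rewrite !le_min => /and3P[h1 h2 h3].
  by split=> //; rewrite -ler_pdivlMr// ?div1r.
pose Kx := 22 * L + 12 * M.
pose Kv := (2 * L + 2 * M) * (1 + 4 * (10 * L + 8 * M + 2 * kappa)) + (8 * L + 6 * M + kappa).
pose K := 2 * L + 4 * (10 * L + 8 * M + 2 * kappa).
have Kx0 : 0 < Kx by rewrite /Kx; have := L_gt0; have := M_gt0; lra.
have q0 : 0 < 2 * L + 2 * M by have := L_gt0; have := M_gt0; lra.
have Kv0 : 0 < Kv.
  rewrite /Kv addr_gt0//; last by have := L_gt0; have := M_gt0; lra.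
  by rewrite mulr_gt0//; have := L_gt0; have := M_gt0; lra.
have K0 : 0 < K by rewrite /K; have := L_gt0; have := M_gt0; lra.
(* [coercive_step] gives the rate [c0 / 2]; half of it absorbs the errors of order [rho] in the same
   variable. *)
exists (c0 / 4), K, abar, bbar; split; first by split => //; rewrite divr_gt0.
split.
  have [h1 _] := ab1 _ (lexx abar); have [h2 h3 _] := bb1 _ (lexx bbar).
  have q4 t : t * c0 <= 1 -> t * (c0 / 4) <= 1 by lra.
  by split => //; exact: q4.
move=> eps B eps0 B0.
pose rho := Num.min (Num.min 1 B) (Num.min (Num.min (rho0 / 2) (2 * L + 2 * M)^-1)
  (Num.min (c0 / 4 / Kx) (Num.min (eps / Kx) (c0 / 4 / Kv)))).
have rho_gt0 : 0 < rho.
  by rewrite !lt_min ltr01 B0 invr_gt0 q0 !divr_gt0.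
have : rho <= rho by [].
rewrite {2}/rho !le_min => /and5P[/andP[r1 rB] /andP[r2 r3] r4 r5 r6].
exists rho; first by rewrite rho_gt0.
rewrite ler_pdivlMr// in r4; rewrite ler_pdivlMr// in r5; rewrite ler_pdivlMr// in r6.
rewrite ler_pdivlMr// in r2; rewrite -[_^-1]div1r ler_pdivlMr// in r3.
move=> h x v x' v' h0 hr xv x'v'.
have ev0 := normr_ge0 (v - v'); have ex0 := normr_ge0 (x - x').
split=> [a a0 aa|b b0 bb].
  have [h1 h2] := ab1 _ aa.
  apply: (le_trans (xstep_lipschitz h0 hr r1 _ xv x'v' a0 (ltW c00) c0m c0l h2 h1)).
    by rewrite mulrC.
  rewrite -/Kx (mulrC Kx).
  have e1 : a * (rho * Kx * `|x - x'|) <= a * (c0 / 4 * `|x - x'|).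
    by rewrite ler_wpM2l// ler_wpM2r.
  have e2 : a * (rho * Kx * `|v - v'|) <= a * (eps * `|v - v'|).
    by rewrite ler_wpM2l// ler_wpM2r.
  lra.
have [h1 h2 h3] := bb1 _ bb.
apply: (le_trans (vstep_lipschitz h0 hr r1 _ xv x'v' b0 h1 (ltW c00) c0k h3 h2 _)).
- by rewrite mulrC.
- by rewrite mulrC.
rewrite -/Kv -/K (mulrC Kv).
have e2 : b * (rho * Kv * `|v - v'|) <= b * (c0 / 4 * `|v - v'|).
  by rewrite ler_wpM2l// ler_wpM2r.
lra.
Qed.

(** Since [g xs = 0] and the linear terms at [h v] and [- h v] cancel, only the second-order
    remainders are left. *)
Lemma mean_grad_saddle h v : 0 < h -> h <= rho0 -> `|v| = 1 ->
  `|mean_grad h xs v| <= L * h ^+ 2.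
Proof.
move=> h0 hr v1.
have hv : `|h *: v| = h by rewrite normrZ v1 mulr1 gtr0_norm.
have z0 : `|xs - xs| <= h by rewrite subrr normr0 ltW.
have s1 : `|xs + h *: v - xs| <= h by rewrite addrAC subrr add0r hv.
have s2 : `|xs - h *: v - xs| <= h by rewrite addrAC subrr add0r normrN hv.
have := g_lin hr s1 z0; have := g_lin hr s2 z0; rewrite g_xs !subr0.
have -> : xs + h *: v - xs = h *: v by vec_ring.
have -> : xs - h *: v - xs = - (h *: v) by vec_ring.
have AN : A (- (h *: v)) = - A (h *: v) by rewrite -scaleN1r linearZ/= scaleN1r.
rewrite AN normrN hv => h1 h2.
have -> : mean_grad h xs v = 2^-1 *: ((g (xs + h *: v) - A (h *: v)) +
    (g (xs - h *: v) - - A (h *: v))).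
  by rewrite /mean_grad; vec_ring.
rewrite normrZ ger0_norm//.
by have := normD_le h2 h1; rewrite expr2; lra.
Qed.

Lemma xstep_saddle h a v : 0 < h -> h <= rho0 -> `|v| = 1 -> 0 <= a ->
  `|xstep h a xs v - xs| <= a * (3 * (L * h ^+ 2)).
Proof.
move=> h0 hr v1 a0; have hG := mean_grad_saddle h0 hr v1.
have -> : xstep h a xs v - xs =
    - (a *: (mean_grad h xs v - 2 *: (dotp v (mean_grad h xs v) *: v))).
  by rewrite /xstep; vec_ring.
rewrite normrN normrZ ger0_norm// ler_wpM2l//.
have h2 : `|2 *: (dotp v (mean_grad h xs v) *: v)| <= 2 * (1 * (L * h ^+ 2) * 1).
  apply: normZ_le; first by rewrite ger0_norm.
  by apply: normZ_le; rewrite ?v1//; apply: dotp_norm_le; rewrite ?v1.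
by apply: (le_trans (normB_le hG h2)); lra.
Qed.

Lemma vstep_saddle h b x r : 0 < h -> `|x - xs| <= r -> r + h <= rho0 ->
  L * (r + h) <= 1 -> 0 <= b -> b <= 1 -> `|vstep h b x vs - vs| <= b * (5 * (L * (r + h))).
Proof.
move=> h0 xr rr Lr b0 b1.
have := curv_approx h0 xr rr vs1; rewrite A_vs => hc.
have hs := le_trans (rotation_dir_le h x ls vs1) hc.
rewrite /vstep; move: (rotation_dir h x vs) hs => s hs.
have nb : `|b *: s| <= b * (L * (r + h)) by rewrite normrZ ger0_norm// ler_wpM2l.
have b1s : `|b *: s| <= 1.
  by apply: (le_trans nb); rewrite mulr_ile1// (le_trans (normr_ge0 _) hs).
have t0 : `|0 : X| <= `|b *: s| by rewrite normr0.
(* Comparing with the zero step at [t = |b s| <= 1] leaves a remainder of at most [4 * |b s|]; the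
   step itself makes it 5. *)
have := geodesic_lipschitz vs vs1 b1s (lexx _) t0.
have -> : geodesic vs 0 = vs by rewrite /geodesic normr0 cos0 sin0 scale1r scale0r addr0.
rewrite subrr subr0 normr0 mulr0 add0r subr0 => hg.
have -> : geodesic vs (b *: s) - vs = (geodesic vs (b *: s) - vs - b *: s) + b *: s.
  by rewrite subrK.
apply: (le_trans (normD_le hg (lexx _))).
have : `|b *: s| * `|b *: s| <= 1 * `|b *: s| by rewrite ler_wpM2r.
by move: nb; move: (`|b *: s|) => n; lra.
Qed.
End LocalModel.

(** * Fixed points and convergence *)

Section FixedPoint.
Context {R : realType} {V : completeNormedModType R}.

Lemma contraction_fixed_point (f : V -> V) (U : set V) (q : R) :
  closed U -> U !=set0 -> (forall x, U x -> U (f x)) -> 0 <= q < 1 ->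
  (forall x y, U x -> U y -> `|f x - f y| <= q * `|x - y|) -> exists2 p, U p & f p = p.
Proof.
move=> Uc U0 Uf /andP[q0 q1] fq.
have fU : set_fun U U f by [].
pose F : {fun U >-> U} := mkfun fU.
have [|p Up pE] := @banach_fixed_point R V U F _ Uc U0; last by exists p.
exists (NngNum q0); split => //= -[x y] [Ux Uy]; exact: fq.
Qed.

Lemma closed_norm_le (a : V) (r : R) : closed [set x | `|x - a| <= r].
Proof.
have -> : [set x | `|x - a| <= r] = (fun x => `|x - a|) @^-1` [set y | y <= r] by [].
apply: closed_comp; last exact: closed_le.
by move=> x _; apply: cvg_norm; apply: cvgB; [exact: cvg_id|exact: cvg_cst].
Qed.

Lemma closed_sphere : closed [set x : V | `|x| = 1].
Proof.
have -> : [set x : V | `|x| = 1] = (fun x => `|x|) @^-1` [set y | y = 1] by [].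
apply: closed_comp; last exact: closed_eq.
by move=> x _; exact: norm_continuous.
Qed.

End FixedPoint.

Section GeodesicFacts.
Context {R : realType} {X : hilbertType R}.
Implicit Types u v : X.

Lemma geodesic0 v : geodesic v 0 = v.
Proof. by rewrite /geodesic normr0 cos0 sin0 scale1r scale0r addr0. Qed.

Lemma geodesic_norm v u : `|v| = 1 -> dotp v u = 0 -> `|geodesic v u| = 1.
Proof.
move=> v1 vu; have [->|u0] := eqVneq u 0; first by rewrite geodesic0.
apply/eqP; rewrite -(@eqrXn2 _ 2)// expr1n; apply/eqP.
rewrite /geodesic normD_sqr !dotp_lin vu !normrZ v1 normfV normr_id mulVf ?normr_eq0//.
by rewrite !mulr1 !mulr0 addr0 !real_normK ?num_real// cos2Dsin2.
Qed.

(** A return to [v] forces [cos |u| = 1], and [|u| <= 1 < pi] excludes a full turn. *)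
Lemma geodesic_fixed v u : `|v| = 1 -> dotp v u = 0 -> `|u| <= 1 -> geodesic v u = v -> u = 0.
Proof.
move=> v1 vu u1 guv; apply/eqP; apply: contraT => u0.
have up : 0 < `|u| by rewrite normr_gt0.
have c1 : cos `|u| = 1.
  have := congr1 (dotp v) guv.
  by rewrite /geodesic !dotp_lin vu dotp_norm v1 !mulr0 addr0 expr1n mulr1.
have sp : 0 < sin `|u|.
  by apply: sin_gt0_pi; rewrite up/= (le_lt_trans u1)// (lt_le_trans _ (pi_ge2 R))// ltr1n.
by have := cos2Dsin2 `|u|; rewrite c1 expr1n; have := exprn_gt0 2 sp; lra.
Qed.

Lemma rotation_dir_orth (g : X -> X) h x v : `|v| = 1 -> dotp v (rotation_dir g h x v) = 0.
Proof. by move=> v1; rewrite /rotation_dir !dotp_lin dotp_norm v1; ring. Qed.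

Lemma vstep_norm (g : X -> X) h b x v : `|v| = 1 -> `|vstep g h b x v| = 1.
Proof. by move=> v1; rewrite geodesic_norm// dotpZr rotation_dir_orth// mulr0. Qed.

Lemma vstep_critical (g : X -> X) h b x v : rotation_dir g h x v = 0 -> vstep g h b x v = v.
Proof. by move=> s0; rewrite /vstep s0 scaler0 geodesic0. Qed.

(* [xstep] reflects the gradient across [v], so a fixed point kills the gradient. *)
Lemma xstep_fixed (g : X -> X) h a x v : 0 < a -> `|v| = 1 -> xstep g h a x v = x ->
  mean_grad g h x v = 0.
Proof.
move=> a0 v1; rewrite /xstep; move: (mean_grad g h x v) => G H.
have : a *: (G - 2 *: (dotp v G *: v)) = 0.
  by apply/eqP; rewrite -oppr_eq0; apply/eqP; apply: (addrI x); rewrite addr0.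
move/eqP; rewrite scaler_eq0 gt_eqF//= => /eqP G0.
have := congr1 (dotp v) G0; rewrite !dotp_lin dotp_norm v1 expr1n => h1.
have vG : dotp v G = 0 by lra.
by move: G0; rewrite vG scale0r scaler0 subr0.
Qed.

End GeodesicFacts.

Section DimerIteration.
Context {R : realType} {X : hilbertType R}.
Variables (E : X -> R) (h : R).
Hypothesis E1 : forall x, is_diff x (E : X -> R^o) (dotp (grad E x)).
Hypothesis h_gt0 : 0 < h.
Let g := grad E.

Lemma curvE x v : h ^- 2 *: dimer_gradv E h x v = curv g h x v.
Proof.
rewrite dimer_gradvE// scalerA /curv; congr (_ *: _); field.
by rewrite gt_eqF.
Qed.

Lemma dimer_dirE x v : dimer_dir E h x v = rotation_dir g h x v.
Proof. by rewrite /dimer_dir /tensor curvE. Qed.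

Lemma dimer_step_xE a x v : dimer_step_x E h a x v = xstep g h a x v.
Proof. by rewrite /dimer_step_x /tensor dimer_gradxE. Qed.

(** The algorithm normalises [s], the geodesic normalises [b s]; positivity of [b] makes the two
    directions agree. *)
Lemma dimer_step_vE b x v : 0 < b -> dimer_step_v E h b x v = vstep g h b x v.
Proof.
move=> b0; rewrite /dimer_step_v dimer_dirE /vstep /geodesic normrZ gtr0_norm// (mulrC b).
congr (_ + _ *: _); rewrite scalerA; congr (_ *: _).
by rewrite invfM -mulrA mulVf ?mulr1// gt_eqF.
Qed.

Lemma dimer_energy_even x v : dimer_energy E h x (- v) = dimer_energy E h x v.
Proof. by rewrite /dimer_energy scalerN opprK addrC. Qed.

(** This makes Algorithm 2 insensitive to the sign of the chosen minimiser. *)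
Lemma xstep_even a x v : xstep g h a x (- v) = xstep g h a x v.
Proof.
rewrite /xstep; have -> : mean_grad g h x (- v) = mean_grad g h x v.
  by rewrite /mean_grad scalerN opprK addrC.
move: (mean_grad g h x v) => G.
have -> // : dotp (- v) G *: - v = dotp v G *: v.
by rewrite dotpNl scaleNr scalerN opprK.
Qed.

End DimerIteration.

(** * Critical directions, the dimer saddle and linear convergence *)

Section Iteration.
Context {R : realType} {X : hilbertType R}.
Variables (g : X -> X) (xs vs : X) (h rho c K eps abar bbar L : R).
Hypothesis vs1 : `|vs| = 1.
Hypothesis h_gt0 : 0 < h.
Hypothesis rho_gt0 : 0 < rho.
Hypothesis c_gt0 : 0 < c.
Hypothesis K_gt0 : 0 < K.
Hypothesis abar_gt0 : 0 < abar.
Hypothesis bbar_gt0 : 0 < bbar.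
Hypothesis abar_le : abar * c <= 1.
Hypothesis bbar_le : bbar * c <= 1.
Hypothesis xstep_contr : forall x v x' v' a, region xs vs rho x v -> region xs vs rho x' v' ->
  0 <= a -> a <= abar -> `|xstep g h a x v - xstep g h a x' v'|
    <= (1 - a * c) * `|x - x'| + a * eps * `|v - v'|.
Hypothesis vstep_contr : forall x v x' v' b, region xs vs rho x v -> region xs vs rho x' v' ->
  0 <= b -> b <= bbar -> `|vstep g h b x v - vstep g h b x' v'|
    <= (1 - b * c) * `|v - v'| + b * K * `|x - x'|.
Hypothesis xstep_near : forall v, `|v| = 1 ->
  `|xstep g h abar xs v - xs| <= abar * (3 * (L * h ^+ 2)).
Hypothesis vstep_near : forall x r, `|x - xs| <= r -> r <= rho ->
  `|vstep g h bbar x vs - vs| <= bbar * (5 * (L * (r + h))).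
Hypothesis rotation_dir_le1 : forall x v, region xs vs rho x v ->
  `|bbar *: rotation_dir g h x v| <= 1.

Let critical x v := region xs vs rho x v /\ rotation_dir g h x v = 0.

Lemma region_vs x : `|x - xs| <= rho -> region xs vs rho x vs.
Proof. by move=> xr; split; rewrite // subrr normr0 ltW. Qed.

(** The contraction leaves a margin [bbar * c * rho] at the boundary of the ball, and the step at
    [vs] is at most that long. *)
Lemma critical_exists r x : r <= rho -> 5 * (L * (r + h)) <= c * rho ->
  `|x - xs| <= r -> exists v, critical x v.
Proof.
move=> rr Lr xr; have xrho := le_trans xr rr.
pose U := [set v : X | `|v - vs| <= rho] `&` [set v : X | `|v| = 1].
have Ureg v : U v -> region xs vs rho x v by case.
have b0 := ltW bbar_gt0.
have [|||||v [vr v1] fv] := @contraction_fixed_point _ _ (fun v => vstep g h bbar x v) U (1 - bbar * c).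
- by apply: closedI; [exact: closed_norm_le|exact: closed_sphere].
- by exists vs; split; rewrite //= subrr normr0 ltW.
- move=> v Uv; have [_ vr v1] := Ureg _ Uv; split => /=; last exact: vstep_norm.
  have h1 := vstep_contr (Ureg _ Uv) (region_vs xrho) b0 (lexx _).
  rewrite subrr normr0 mulr0 addr0 in h1.
  have h2 := vstep_near xr rr.
  have -> : vstep g h bbar x v - vs =
      (vstep g h bbar x v - vstep g h bbar x vs) + (vstep g h bbar x vs - vs).
    by rewrite addrA subrK.
  have h3 : (1 - bbar * c) * `|v - vs| <= (1 - bbar * c) * rho.
    by rewrite ler_wpM2l// subr_ge0.
  have h4 : bbar * (5 * (L * (r + h))) <= bbar * (c * rho) by rewrite ler_wpM2l.
  by apply: (le_trans (normD_le (le_trans h1 h3) (le_trans h2 h4))); lra.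
- by rewrite subr_ge0 bbar_le/= ltrBlDr ltrDl mulr_gt0.
- move=> v w Uv Uw; have := vstep_contr (Ureg _ Uv) (Ureg _ Uw) b0 (lexx _).
  by rewrite subrr normr0 mulr0 addr0.
exists v; split=> //.
have s1 := rotation_dir_le1 (Ureg _ (conj vr v1)).
have : bbar *: rotation_dir g h x v = 0.
  by apply: geodesic_fixed fv => //; rewrite dotpZr rotation_dir_orth// mulr0.
by move/eqP; rewrite scaler_eq0 gt_eqF//= => /eqP.
Qed.

(** Both directions are fixed by [vstep], so the contraction bound holds with [|v - v'|] on both
    sides; rearranging cancels [bbar]. *)
Lemma critical_lipschitz x v x' v' : critical x v -> critical x' v' ->
  c * `|v - v'| <= K * `|x - x'|.
Proof.
move=> [xv s0] [xv' s0'].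
have := vstep_contr xv xv' (ltW bbar_gt0) (lexx _).
rewrite !vstep_critical// => H.
by rewrite -(ler_pM2l bbar_gt0); lra.
Qed.

Lemma critical_near r x v : critical x v -> `|x - xs| <= r -> r <= rho ->
  c * `|v - vs| <= 5 * (L * (r + h)).
Proof.
move=> [xv s0] xr rr.
have := vstep_contr xv (region_vs (le_trans xr rr)) (ltW bbar_gt0) (lexx _).
rewrite vstep_critical// subrr normr0 mulr0 addr0 => h1.
have h2 := vstep_near xr rr.
have : `|v - vs| <= (1 - bbar * c) * `|v - vs| + bbar * (5 * (L * (r + h))).
  have {1}-> : v - vs = (v - vstep g h bbar x vs) + (vstep g h bbar x vs - vs).
    by rewrite addrA subrK.
  exact: (normD_le h1 h2).
move=> H; by rewrite -(ler_pM2l bbar_gt0); lra.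
Qed.

Hypothesis eps_ge0 : 0 <= eps.
Hypothesis eps_le : 2 * K * eps <= c ^+ 2.

(** Along critical directions [|v - v'| <= K / c * |x - x'|], and [2 * K * eps <= c ^ 2] turns the
    coupling into half of the rate. *)
Lemma critical_xstep x v x' v' a : critical x v -> critical x' v' -> 0 <= a -> a <= abar ->
  `|xstep g h a x v - xstep g h a x' v'| <= (1 - a * c / 2) * `|x - x'|.
Proof.
move=> cx cx' a0 aa.
have vl := critical_lipschitz cx cx'.
have H := xstep_contr cx.1 cx'.1 a0 aa.
have e1 : eps * (c * `|v - v'|) <= eps * (K * `|x - x'|) by rewrite ler_wpM2l.
have e2 : 2 * K * eps * `|x - x'| <= c ^+ 2 * `|x - x'| by rewrite ler_wpM2r.
have e3 : eps * `|v - v'| <= c / 2 * `|x - x'|.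
  by rewrite expr2 in e2; rewrite -(ler_pM2l c_gt0); lra.
have e4 : a * (eps * `|v - v'|) <= a * (c / 2 * `|x - x'|) by rewrite ler_wpM2l.
lra.
Qed.

Lemma saddle_exists r : 0 <= r -> r <= rho -> 5 * (L * (r + h)) <= c * rho ->
  3 * (L * h ^+ 2) <= c / 2 * r ->
  exists x v, [/\ critical x v, `|x - xs| <= r & mean_grad g h x v = 0].
Proof.
move=> r0 rr Lr Lh.
(* Any selection of critical directions will do, since [critical_xstep] holds for all of them;
   outside the ball the value is a dummy. *)
have /choice[vb vbP] : forall x, exists v, `|x - xs| <= r -> critical x v.
  move=> x; have [xr|/negP xr] := boolP (`|x - xs| <= r); last by exists 0.
  by have [v cv] := critical_exists rr Lr xr; exists v.
have a0 := ltW abar_gt0.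
have q0 : 0 <= 1 - abar * c / 2 by have := abar_le; lra.
have xsr : `|xs - xs| <= r by rewrite subrr normr0.
have [|||||x xr fx] := @contraction_fixed_point _ _ (fun x => xstep g h abar x (vb x))
    [set x : X | `|x - xs| <= r] (1 - abar * c / 2).
- exact: closed_norm_le.
- by exists xs.
- move=> x /= xr; have h1 := critical_xstep (vbP _ xr) (vbP _ xsr) a0 (lexx _).
  have [[_ _ v1] _] := vbP _ xsr.
  have h2 := xstep_near v1.
  have -> : xstep g h abar x (vb x) - xs = (xstep g h abar x (vb x) -
    xstep g h abar xs (vb xs)) + (xstep g h abar xs (vb xs) - xs) by rewrite addrA subrK.
  have h3 : (1 - abar * c / 2) * `|x - xs| <= (1 - abar * c / 2) * r by rewrite ler_wpM2l.
  have h4 : abar * (3 * (L * h ^+ 2)) <= abar * (c / 2 * r) by rewrite ler_wpM2l.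
  by apply: (le_trans (normD_le (le_trans h1 h3) (le_trans h2 h4))); lra.
- by rewrite q0/= ltrBlDr ltrDl divr_gt0// mulr_gt0.
- by move=> x y xr yr; apply: critical_xstep => //; exact: vbP.
have cx := vbP _ xr; have [[_ _ v1] _] := cx.
exists x, (vb x); split => //.
exact: xstep_fixed abar_gt0 v1 fx.
Qed.

Lemma xstep_zero a x v : mean_grad g h x v = 0 -> xstep g h a x v = x.
Proof. by move=> G0; rewrite /xstep G0 dotp0r scale0r !scaler0 subrr scaler0 subr0. Qed.

Variables (xh vh : X).
Hypothesis crit_h : critical xh vh.
Hypothesis mean_grad_h : mean_grad g h xh vh = 0.

(** Induction on the weighted maximum of the errors. [2 * eps <= c * delta] and [2 * K * delta <= c]
    each bound a coupling by half of the rate; the two conditions involving [rho] keep the iterates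
    in the region. *)
Lemma alternating_convergence (delta m a0 b0 : R) (alpha beta : nat -> R) (x v : nat -> X) :
  0 < delta -> 2 * K * delta <= c -> 2 * eps <= c * delta ->
  0 < a0 -> (forall k, a0 <= alpha k <= abar) -> 0 < b0 -> (forall k, b0 <= beta k <= bbar) ->
  `|v 0%N| = 1 -> (forall k, x k.+1 = xstep g h (alpha k) (x k) (v k)) ->
  (forall k, v k.+1 = vstep g h (beta k) (x k) (v k)) ->
  `|x 0%N - xh| <= m -> delta * `|v 0%N - vh| <= m ->
  m + `|xh - xs| <= rho -> m / delta + `|vh - vs| <= rho ->
  exists2 eta : R, 0 < eta < 1 & forall k,
    `|x k - xh| <= m * eta ^+ k /\ delta * `|v k - vh| <= m * eta ^+ k.
Proof.
move=> d0 dK de a00 ha b00 hb v01 xS vS x0 v0 mx mv.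
pose eta := Num.max (1 - a0 * c / 2) (1 - b0 * c / 2).
have m0 : 0 <= m := le_trans (normr_ge0 _) x0.
have eta01 : 0 < eta < 1.
  rewrite lt_max gt_max !ltrBlDr !ltrDl !divr_gt0 ?mulr_gt0// !andbT.
  apply/orP; left; have /andP[h1 h2] := ha 0%N.
  have : a0 * c <= abar * c by rewrite ler_pM2r// (le_trans h1).
  by have := abar_le; lra.
have /andP[eta0 eta1] := eta01.
exists eta => //.
have H k : [/\ `|x k - xh| <= m * eta ^+ k, delta * `|v k - vh| <= m * eta ^+ k & `|v k| = 1].
  elim: k => [|k [xk vk v1]]; first by rewrite expr0 mulr1.
  have ek0 : 0 <= m * eta ^+ k by rewrite mulr_ge0// exprn_ge0// ltW.
  have ek1 : m * eta ^+ k <= m by rewrite ler_piMr// exprn_ile1 ?ltW.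
  have vk' : `|v k - vh| <= m * eta ^+ k / delta by rewrite ler_pdivlMr// mulrC.
  have rk : region xs vs rho (x k) (v k).
    split => //.
      have -> : x k - xs = (x k - xh) + (xh - xs) by rewrite addrA subrK.
      by apply: le_trans (normD_le (le_trans xk ek1) (lexx _)) mx.
    have -> : v k - vs = (v k - vh) + (vh - vs) by rewrite addrA subrK.
    apply: le_trans (normD_le vk' (lexx _)) _; apply: le_trans mv; rewrite lerD2r.
    by rewrite ler_pM2r ?invr_gt0.
  have /andP[a1 a2] := ha k; have /andP[b1 b2] := hb k.
  have ak0 : 0 <= alpha k by rewrite (le_trans (ltW a00)).
  have bk0 : 0 <= beta k by rewrite (le_trans (ltW b00)).
  have Hx := xstep_contr rk crit_h.1 ak0 a2.
  have Hv := vstep_contr rk crit_h.1 bk0 b2.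
  (* The dimer saddle is fixed by steps of every length, so varying step lengths are compared with
     one fixed point. *)
  rewrite (xstep_zero _ mean_grad_h) -xS in Hx; rewrite (vstep_critical _ crit_h.2) -vS in Hv.
  have ac1 : alpha k * c <= 1.
    by apply: le_trans abar_le; rewrite ler_pM2r.
  have bc1 : beta k * c <= 1.
    by apply: le_trans bbar_le; rewrite ler_pM2r.
  have ge1 : 1 - a0 * c / 2 <= eta by rewrite /eta le_max lexx.
  have ge2 : 1 - b0 * c / 2 <= eta by rewrite /eta le_max lexx orbT.
  have aca : a0 * c <= alpha k * c by rewrite ler_pM2r.
  have bcb : b0 * c <= beta k * c by rewrite ler_pM2r.
  have le_eta (t : R) : t <= eta -> t * (m * eta ^+ k) <= m * eta ^+ k.+1.
    by move=> te; rewrite exprS (mulrCA m); exact: ler_wpM2r.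
  move: xk vk Hx Hv ek0; set q := m * eta ^+ k in le_eta *.
  set ex := `|x k - xh|; set ev := `|v k - vh| => xk vk Hx Hv q0.
  have ev0 : 0 <= ev by rewrite /ev.
  split; last by rewrite vS; exact: vstep_norm.
  - apply: (le_trans Hx); apply: le_trans (le_eta (1 - alpha k * c / 2) _); last by lra.
    have e1 : (1 - alpha k * c) * ex <= (1 - alpha k * c) * q by rewrite ler_wpM2l// subr_ge0.
    have e2 : 2 * eps * ev <= c * delta * ev by rewrite ler_wpM2r.
    have e3 : c * (delta * ev) <= c * q by rewrite ler_wpM2l// ltW.
    have e4 : alpha k * (eps * ev) <= alpha k * (c / 2 * q) by rewrite ler_wpM2l//; lra.
    lra.
  - have Hv' : delta * `|v k.+1 - vh| <= delta * ((1 - beta k * c) * ev + beta k * K * ex).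
      by rewrite ler_pM2l.
    apply: (le_trans Hv'); apply: le_trans (le_eta (1 - beta k * c / 2) _); last by lra.
    have e1 : (1 - beta k * c) * (delta * ev) <= (1 - beta k * c) * q.
      by rewrite ler_wpM2l// subr_ge0.
    have e2 : 2 * K * delta * ex <= c * ex by rewrite ler_wpM2r// /ex.
    have e3 : c * ex <= c * q by rewrite ler_wpM2l// ltW.
    have e4 : beta k * (K * delta * ex) <= beta k * (c / 2 * q) by rewrite ler_wpM2l//; lra.
    lra.
by move=> k; have [] := H k.
Qed.

End Iteration.

(** * Minimisers of the dimer energy on the sphere *)

Section ArgMin.
Context {R : realType} {X : hilbertType R}.
Variables (E : X -> R) (A : 'L(X, X)) (xs vs : X) (ls mu L rho0 M rho h : R).
Let g := grad E.
Hypothesis A_sym : forall w z, dotp (A w) z = dotp w (A z).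
Hypothesis A_vs : A vs = ls *: vs.
Hypothesis vs1 : `|vs| = 1.
Hypothesis A_coercive : forall w, dotp vs w = 0 -> mu * `|w| ^+ 2 <= dotp (A w) w.
Hypothesis mu_gt_ls : 0 < mu - ls.
Hypothesis L_gt0 : 0 < L.
Hypothesis M_gt0 : 0 < M.
Hypothesis A_le : forall w, `|A w| <= M * `|w|.
Hypothesis g_lin : forall r y z, r <= rho0 -> `|y - xs| <= r -> `|z - xs| <= r ->
  `|g y - g z - A (y - z)| <= L * r * `|y - z|.
Hypothesis E_quad : forall r y z, r <= rho0 -> `|y - xs| <= r -> `|z - xs| <= r ->
  `|E y - E z - dotp (g z) (y - z) - 2^-1 * dotp (A (y - z)) (y - z)|
    <= L * r * `|y - z| ^+ 2.
Hypothesis h_gt0 : 0 < h.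
Hypothesis h_le : h <= rho.
Hypothesis rho_le : rho <= 1 / 16.
Hypothesis rho_le0 : 2 * rho <= rho0.
Hypothesis rho_small : (6 * L + 2 * M) * rho <= (mu - ls) / 8.

(** Taylor expansion at [x + h vb] and [x - h vb]. Criticality makes the gradient difference
    [2 * h * l *: vb], and [dotp vb d = - |d| ^ 2 / 2] for unit vectors, so the first-order part
    becomes quadratic: the gap is [h ^ 2 / 2] times [dotp (A d) d - l * |d| ^ 2], up to
    [4 * L * rho * |d| ^ 2] in that factor. The hemisphere condition keeps [d] away from the
    degenerate direction [vs]. *)
Lemma energy_gap x vb w : region xs vs rho x vb -> rotation_dir g h x vb = 0 ->
  `|w| = 1 -> 0 <= dotp w vb ->
  dimer_energy E h x vb + h ^+ 2 * ((mu - ls) / 16) * `|w - vb| ^+ 2 <= dimer_energy E h x w.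
Proof.
move=> xv s0 w1 wv; have [xr vr v1] := xv.
have rho0' : 0 < rho := lt_le_trans h_gt0 h_le.
have sD u : `|u| = 1 -> `|x + h *: u - xs| <= 2 * rho.
  move=> u1; rewrite addrAC; have hu : `|h *: u| <= rho by rewrite normrZ u1 mulr1 gtr0_norm.
  by apply: (le_trans (normD_le xr hu)); lra.
have sB u : `|u| = 1 -> `|x - h *: u - xs| <= 2 * rho.
  move=> u1; rewrite addrAC; have hu : `|h *: u| <= rho by rewrite normrZ u1 mulr1 gtr0_norm.
  by apply: (le_trans (normB_le xr hu)); lra.
have tc z : (mu - ls) * `|z| ^+ 2 <=
    dotp (A z) z - ls * `|z| ^+ 2 + (mu - ls) * (dotp vs z) ^+ 2.
  have := T_coercive A_sym A_vs vs1 A_coercive z.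
  by rewrite /= !dotp_lin dotp_norm; lra.
set d := w - vb; have {}tc := tc d.
have Fp := E_quad rho_le0 (sD _ w1) (sD _ v1).
have Fm := E_quad rho_le0 (sB _ w1) (sB _ v1).
have dp : x + h *: w - (x + h *: vb) = h *: d by rewrite /d; vec_ring.
have dm : x - h *: w - (x - h *: vb) = (- h) *: d by rewrite /d; vec_ring.
have AZ a : A (a *: d) = a *: A d by rewrite linearZ.
rewrite dp AZ !dotpZr !dotpZl normrZ exprMn real_normK ?num_real// in Fp.
rewrite dm AZ !dotpZr !dotpZl normrZ exprMn real_normK ?num_real// in Fm.
pose l := dotp vb (curv g h x vb).
have cE : curv g h x vb = l *: vb.
  by move/eqP: s0; rewrite /rotation_dir oppr_eq0 subr_eq0 => /eqP.
have gE : g (x + h *: vb) - g (x - h *: vb) = (2 * h * l) *: vb.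
  rewrite -scalerA -cE /curv scalerA divff ?scale1r//.
  by rewrite mulf_neq0// gt_eqF.
have vd : dotp vb d = - (`|d| ^+ 2 / 2).
  by rewrite /d normB_sqr !dotp_lin dotp_norm v1 w1 (dotpC w); field.
have gd : dotp (g (x + h *: vb)) d - dotp (g (x - h *: vb)) d = - (h * l * `|d| ^+ 2).
  by rewrite -dotpNl -dotpDl gE dotpZl vd; field.
have hl : `|l - ls| <= 1 * ((2 * L + M) * rho) + M * (1 * rho).
  have -> : l - ls = dotp vb (curv g h x vb - ls *: vs) + ls * dotp vb (vs - vb).
    by rewrite /l !dotp_lin dotp_norm v1; ring.
  have lsM : `|ls| <= M by have := A_le vs; rewrite A_vs normrZ vs1 !mulr1.
  apply: absD_le.
    apply: dotp_norm_le; first by rewrite v1.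
    exact: (curv_near A_vs L_gt0 M_gt0 A_le g_lin h_gt0 h_le rho_le0 xv).
  by apply: absM_le => //; apply: dotp_norm_le; rewrite ?v1// distrC.
have d2 : `|d| ^+ 2 <= 2.
  by rewrite /d normB_sqr w1 v1; lra.
have hs : `|dotp vs d| <= `|d| ^+ 2 / 2 + rho * `|d|.
  have -> : dotp vs d = dotp vb d + dotp (vs - vb) d by rewrite dotpDl dotpNl; ring.
  apply: absD_le; last by apply: dotp_norm_le; rewrite // distrC.
  by rewrite vd normrN ger0_norm// divr_ge0// exprn_ge0.
(* In the hemisphere [|d| <= 3 / 2], so with [rho <= 1 / 16] the overlap is at most
   [(3 / 4 + 1 / 16) * |d|], whose square is below [3 / 4 * |d| ^ 2]. A quarter of [mu - ls] is
   left, and [rho_small] takes half of that. *)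
have sq : (dotp vs d) ^+ 2 <= 3 / 4 * `|d| ^+ 2.
  have d32 : `|d| <= 3 / 2 by have := normr_ge0 d; nra.
  have n0 := normr_ge0 d.
  have t1 : `|dotp vs d| <= 13 / 16 * `|d|.
    by apply: (le_trans hs); rewrite expr2; have := rho_le; nra.
  rewrite -real_normK ?num_real//.
  have : `|dotp vs d| ^+ 2 <= (13 / 16 * `|d|) ^+ 2.
    by rewrite ler_pXn2r ?nnegrE// mulr_ge0.
  rewrite exprMn => /le_trans; apply; apply: ler_wpM2r; first exact: exprn_ge0.
  by lra.
have n0 : 0 <= `|d| ^+ 2 by exact: exprn_ge0.
have h2 : 0 < h ^+ 2 by exact: exprn_gt0.
have key : (mu - ls) / 8 * `|d| ^+ 2 <= dotp (A d) d - l * `|d| ^+ 2 - 4 * L * rho * `|d| ^+ 2.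
  have e1 : (mu - ls) * (dotp vs d) ^+ 2 <= (mu - ls) * (3 / 4 * `|d| ^+ 2).
    by rewrite ler_pM2l.
  have e2 : (l - ls) * `|d| ^+ 2 <= (1 * ((2 * L + M) * rho) + M * (1 * rho)) * `|d| ^+ 2.
    by apply: ler_wpM2r => //; apply: le_trans hl; exact: ler_norm.
  have e3 : (6 * L + 2 * M) * rho * `|d| ^+ 2 <= (mu - ls) / 8 * `|d| ^+ 2.
    exact: ler_wpM2r.
  lra.
have key2 : h ^+ 2 * ((mu - ls) / 8 * `|d| ^+ 2) <=
   h ^+ 2 * (dotp (A d) d - l * `|d| ^+ 2 - 4 * L * rho * `|d| ^+ 2) by rewrite ler_pM2l.
move: Fp Fm; rewrite !ler_norml => /andP[Fp _] /andP[Fm _].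
have gd2 : h * (dotp (g (x + h *: vb)) d - dotp (g (x - h *: vb)) d)
  = - (h ^+ 2 * l * `|d| ^+ 2) by rewrite gd; ring.
rewrite /dimer_energy sqrrN in Fm *; rewrite !expr2 in Fp Fm key2 gd2 *.
lra.
Qed.

(** The gap is strict on the hemisphere of [vb]; evenness of the energy transfers it to the
    hemisphere of [- vb]. *)
Lemma dimer_argminE x vb : region xs vs rho x vb -> rotation_dir g h x vb = 0 ->
  dimer_argmin E h x = [set vb; - vb].
Proof.
move=> xv s0; have [_ _ v1] := xv.
have k0 : 0 < h ^+ 2 * ((mu - ls) / 16) by rewrite mulr_gt0 ?exprn_gt0// divr_gt0.
have gap w : `|w| = 1 -> 0 <= dotp w vb ->
    dimer_energy E h x vb <= dimer_energy E h x w /\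
    (dimer_energy E h x w <= dimer_energy E h x vb -> w = vb).
  move=> w1 wv; have H := energy_gap xv s0 w1 wv; split.
    by apply: le_trans H; rewrite lerDl mulr_ge0 ?(ltW k0)// exprn_ge0.
  move=> le_w; have {H} := le_trans H le_w.
  rewrite gerDl pmulr_rle0// => H; apply/eqP; rewrite -subr_eq0 -normr_eq0 -sqrf_eq0.
  by rewrite eq_le H exprn_ge0.
have nw w : dotp w vb <= 0 -> 0 <= dotp (- w) vb by rewrite dotpNl oppr_ge0.
have min w : `|w| = 1 -> dimer_energy E h x vb <= dimer_energy E h x w.
  move=> w1; have [wv|/ltW wv] := leP 0 (dotp w vb); first exact: (gap w w1 wv).1.
  by rewrite -(dimer_energy_even E h x w); apply: (gap _ _ (nw _ wv)).1; rewrite normrN.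
apply/seteqP; split => [w [w1 wmin]|w [->|->]] /=.
- have [wv|/ltW wv] := leP 0 (dotp w vb); [left|right].
    by apply: (gap w w1 wv).2; exact: wmin.
  rewrite -(opprK w); congr (- _); apply: (gap _ _ (nw _ wv)).2; first by rewrite normrN.
  by rewrite dimer_energy_even; exact: wmin.
- by split.
- by split; [rewrite normrN|move=> u u1; rewrite dimer_energy_even; exact: min].
Qed.

End ArgMin.

(** * Step-length bounds, choice of radii and the convergence theorem *)

Lemma admissible_stepsP {R : realType} (abar : R) (alpha : nat -> R) :
  admissible_steps abar alpha ->
  exists2 a0 : R, 0 < a0 & forall k, a0 <= alpha k <= abar.
Proof.
move=> [hs hi].
set S := [set (alpha k)%:E | k in [set: nat]] in hs hi.
have inS k : S (alpha k)%:E by exists k.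
have le_al k : (ereal_inf S <= (alpha k)%:E)%E by apply: ereal_inf_lbound.
have fin : ereal_inf S \is a fin_num.
  rewrite fin_numElt (lt_trans _ hi) ?ltNy0//=.
  by rewrite (le_lt_trans (le_al 0%N))// ltry.
exists (fine (ereal_inf S)); first by rewrite fine_gt0// hi/= -ge0_fin_numE// ltW.
move=> k; rewrite -lee_fin fineK// le_al/= -lee_fin.
by apply: le_trans hs; apply: ereal_sup_ubound.
Qed.

Theorem theorem2p3 (R : realType) (X : hilbertType R) (E : X -> R)
    (E_C4 : is_Cn 4 (E : X -> R^o))
    (xs : X) (saddle_xs : index1_saddle E xs)
    (ls : R) (vs : X) (eig_xs : minimal_eigenpair (hess E xs) ls vs)
    (norm_vs : `|vs| = 1) :
  exists (r h0 abar bbar : R) (xh vh : R -> X) (lh : R -> R),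
    [/\ 0 < r, 0 < h0, 0 < abar & 0 < bbar] /\
    forall h : R, 0 < h -> h <= h0 ->
    [/\ dimer_saddle E h (xh h) (vh h) (lh h),
      (* (a) *)
      (forall (x0 v0 : X) (alpha beta : nat -> R),
        ball xs r x0 -> ball vs r v0 -> `|v0| = 1 ->
        admissible_steps abar alpha -> admissible_steps bbar beta ->
        let x k := (algorithm1 E h alpha beta x0 v0 k).1 in
        let v k := (algorithm1 E h alpha beta x0 v0 k).2 in
        exists C eta : R, [/\ 0 < C, 0 < eta < 1 &
          forall k : nat, `|x k - xh h| + `|v k - vh h|
            <= C * eta ^+ k * (`|x0 - xh h| + `|v0 - vh h|)]) &
      (* (b) *)
      (forall (x0 : X) (alpha : nat -> R),
        ball xs r x0 -> admissible_steps abar alpha ->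
        (exists x v : nat -> X, algorithm2 E h alpha x0 x v) /\
        forall x v : nat -> X, algorithm2 E h alpha x0 x v ->
        [/\ (forall k : nat, dimer_argmin E h (x k) = [set v k; - v k]),
          (exists2 eta : R, 0 < eta < 1 &
            forall k : nat, `|x k.+1 - xh h| <= eta * `|x k - xh h|) &
          (exists C : R, forall k : nat,
            Num.min `|v k - vh h| `|v k + vh h| <= C * `|x k - xh h|)])].
Proof.
have E_C3 := is_CnS E_C4.
have E1 := is_diff_grad_C3 E_C3.
have A_sym := hess_sym xs E_C3.
have [L L0 [rho0 rho00 [F1 F2 F3]]] := grad_estimates xs E_C3.
have [g0 [l [v [_ uniq l0 [mu mu0 coer0]]]]] := saddle_xs.
have [lsl [k0 vsk]] := uniq _ _ eig_xs.
have [_ A_vs _ _] := eig_xs.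
have ls0 : ls < 0 by rewrite lsl.
(* Uniqueness makes [vs] a nonzero multiple of the vector [v] in the saddle structure, so both have
   the same orthogonal complement. *)
have coer w : dotp vs w = 0 -> mu * `|w| ^+ 2 <= dotp (hess E xs w) w.
  rewrite vsk dotpZl => /eqP; rewrite mulf_eq0 => /orP[/eqP k00|/eqP]; last exact: coer0.
  by move: norm_vs; rewrite vsk k00 scale0r normr0 => /esym/eqP; rewrite oner_eq0.
pose M := opnorm (hess E xs) + 1.
have M0 : 0 < M by rewrite ltr_wpDl// opnorm_ge0.
have A_le w : `|hess E xs w| <= M * `|w|.
  by apply: (le_trans (le_opnorm _ _)); rewrite ler_wpM2r// lerDl.
have [c [K [abar [bbar [[c0 K0 ab0 bb0] [[abc bbc bb1] contr]]]]]] :=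
  local_contraction A_sym A_vs norm_vs ls0 mu0 coer L0 M0 rho00 A_le g0 F1 F2.
have kap0 : 0 < mu - ls by rewrite subr_gt0 (lt_trans ls0).
clearbody M; clear uniq coer0 vsk lsl l0 saddle_xs eig_xs E_C3 E_C4.
pose delta := Num.min 1 (c / (2 * K)).
have d0 : 0 < delta by rewrite lt_min ltr01 divr_gt0// mulr_gt0.
have d1 : delta <= 1 by rewrite ge_min lexx.
have dK : 2 * K * delta <= c.
  by rewrite mulrC -ler_pdivlMr ?mulr_gt0// /delta ge_min lexx orbT.
pose eps := c * delta / 2.
have eps0 : 0 < eps by rewrite /eps !divr_gt0// mulr_gt0.
have eps1 : 2 * eps <= c * delta by rewrite /eps; lra.
have eps2 : 2 * K * eps <= c ^+ 2.
  have : c * (2 * K * delta) <= c * c by rewrite ler_pM2l.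
  have : 0 <= c * c by rewrite mulr_ge0 ?(ltW c0).
  by rewrite /eps expr2; lra.
pose q1 := 2 * L + 2 * M; have q10 : 0 < q1 by rewrite /q1; lra.
pose q2 := 6 * L + 2 * M; have q20 : 0 < q2 by rewrite /q2; lra.
(* The region must also suit [energy_gap] (the entries [1 / 16], [rho0 / 2] and the one with [q2])
   and keep rotation directions of norm at most 1 (the one with [q1]). *)
pose B := Num.min (1 / 16) (Num.min (rho0 / 2) (Num.min q1^-1 ((mu - ls) / 8 / q2))).
have B0 : 0 < B by rewrite !lt_min invr_gt0 q10 !divr_gt0.
have [rho /andP[rho_gt0 rhoB] ctr] := contr eps B eps0 B0.
move: rhoB; rewrite !le_min => /and4P[rho16 rho2 rhoq1 rhoq2].
rewrite ler_pdivlMr// mulrC in rho2.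
rewrite -[_^-1]div1r ler_pdivlMr// mulrC in rhoq1.
rewrite ler_pdivlMr// mulrC in rhoq2.
(* Nested radii: critical directions exist within [r2]; [sg] is the tolerance for [vh], small enough
   that an initial error of [2 * sg] divided by [delta] is at most [rho / 2]; [r] is the starting
   radius, with [3 * r <= r2] to hold the iterates of Algorithm 2; [r1] bounds the distance of [xh]
   from [xs] and puts [vh] within [sg]; [h0] makes the displacement of order [h ^ 2] fit into
   [r1]. *)
pose r2 := Num.min rho (c * rho / (10 * L)).
have r20 : 0 < r2 by rewrite lt_min rho_gt0 divr_gt0// mulr_gt0.
have r2rho : r2 <= rho by rewrite ge_min lexx.
have r2c : 10 * L * r2 <= c * rho.
  by rewrite mulrC -ler_pdivlMr ?mulr_gt0// /r2 ge_min lexx orbT.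
pose sg := delta * rho / 4.
have sg0 : 0 < sg by rewrite /sg !divr_gt0// mulr_gt0.
pose r := Num.min sg (r2 / 3).
have r0 : 0 < r by rewrite lt_min sg0 divr_gt0.
have rsg : r <= sg by rewrite ge_min lexx.
have rr2 : 3 * r <= r2 by rewrite mulrC -ler_pdivlMr// /r ge_min lexx orbT.
pose r1 := Num.min r (c * sg / (10 * L)).
have r10 : 0 < r1 by rewrite lt_min r0 divr_gt0// mulr_gt0.
have r1r : r1 <= r by rewrite ge_min lexx.
have r1c : 10 * L * r1 <= c * sg.
  by rewrite mulrC -ler_pdivlMr ?mulr_gt0// /r1 ge_min lexx orbT.
pose h0 := Num.min r1 (c * r1 / (6 * L)).
have h00 : 0 < h0 by rewrite lt_min r10 divr_gt0// mulr_gt0.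
have h0r1 : h0 <= r1 by rewrite ge_min lexx.
have h0c : 6 * L * h0 <= c * r1.
  by rewrite mulrC -ler_pdivlMr ?mulr_gt0// /h0 ge_min lexx orbT.
have r1c' : 5 * (L * (r1 + r1)) <= c * sg by clear -r1c; lra.
have r2r1 : r1 <= r2 by clear -r1r rr2 r0; lra.
have sgd : 4 * sg = delta * rho by rewrite /sg; field.
have sgrho : 4 * sg <= rho by rewrite sgd ler_piMl// ltW.
have q1rho : q1 * rho <= 1 by [].
have q2rho : q2 * rho <= (mu - ls) / 8 by [].
rewrite /q1 in q1rho; rewrite /q2 in q2rho.
clear rhoq1 rhoq2; clearbody delta eps q1 q2 B r2 sg r r1 h0.
pose g := grad E.
pose crit h x v := region xs vs rho x v /\ rotation_dir g h x v = 0.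
have hrho h : h <= h0 -> h <= rho.
  by move=> hh; apply: le_trans hh _; apply: (le_trans h0r1); apply: (le_trans r2r1).
have CX h : 0 < h -> h <= h0 -> forall x v x' v' a, region xs vs rho x v ->
    region xs vs rho x' v' -> 0 <= a -> a <= abar ->
    `|xstep g h a x v - xstep g h a x' v'| <= (1 - a * c) * `|x - x'| + a * eps * `|v - v'|.
  move=> hp hh x v' x' v'' a xv xv' a0 aa.
  exact: (ctr h _ _ _ _ hp (hrho _ hh) xv xv').1.
have CV h : 0 < h -> h <= h0 -> forall x v x' v' b, region xs vs rho x v ->
    region xs vs rho x' v' -> 0 <= b -> b <= bbar ->
    `|vstep g h b x v - vstep g h b x' v'| <= (1 - b * c) * `|v - v'| + b * K * `|x - x'|.
  move=> hp hh x v' x' v'' b xv xv' a0 aa.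
  exact: (ctr h _ _ _ _ hp (hrho _ hh) xv xv').2.
have XN h : 0 < h -> h <= h0 -> forall v, `|v| = 1 ->
    `|xstep g h abar xs v - xs| <= abar * (3 * (L * h ^+ 2)).
  move=> hp hh w w1; apply: (xstep_saddle g0 F1) => //; last exact: ltW.
  by have := hrho _ hh; clear -rho2 rho_gt0; lra.
have VN h : 0 < h -> h <= h0 -> forall x r, `|x - xs| <= r -> r <= rho ->
    `|vstep g h bbar x vs - vs| <= bbar * (5 * (L * (r + h))).
  move=> hp hh x s xr sr; have hr := hrho _ hh.
  apply: (vstep_saddle A_vs norm_vs F1) => //; [by clear -sr hr rho2; lra| |exact: ltW].
  apply: le_trans q1rho; have : L * (s + h) <= L * (2 * rho).
    by rewrite ler_pM2l//; clear -sr hr; lra.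
  have : 0 <= M * rho by rewrite mulr_ge0// ltW.
  clear; lra.
have RD h : 0 < h -> h <= h0 -> forall x v, region xs vs rho x v ->
    `|bbar *: rotation_dir g h x v| <= 1.
  move=> hp hh x w xw; rewrite normrZ gtr0_norm//.
  have s1 := rotation_dir_small A_vs norm_vs L0 M0 A_le F1 hp (hrho _ hh) rho2 xw.
  by apply: mulr_ile1 => //; [exact: ltW|exact: le_trans s1 q1rho].
have /choice[z zP] : forall h, exists z : X * X, 0 < h -> h <= h0 ->
    [/\ crit h z.1 z.2, `|z.1 - xs| <= r1 & mean_grad g h z.1 z.2 = 0].
  move=> h; have [hp|] := boolP (0 < h); last by exists (0, 0).
  have [hh|] := boolP (h <= h0); last by exists (0, 0).
  have hr1 : h <= r1 := le_trans hh h0r1.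
  have [||||x [w H]] := saddle_exists norm_vs rho_gt0 c0 ab0 bb0 abc bbc (CX h hp hh) (CV h hp hh)
    (XN h hp hh) (VN h hp hh) (RD h hp hh) (ltW eps0) eps2 (r := r1); last by exists (x, w).
  - exact: ltW.
  - exact: le_trans r2r1 r2rho.
  - have : L * (r1 + h) <= L * (r2 + r2).
      by rewrite ler_pM2l//; clear -r2r1 hr1; lra.
    clear -r2c; lra.
  - have e1 : h * (6 * L * h) <= h * (c * r1).
      rewrite ler_pM2l//; apply: le_trans h0c; rewrite ler_pM2l//.
      by rewrite mulr_gt0.
    (* The linear bound on [h0] suffices for the quadratic condition because [h <= 1]. *)
    have e2 : h * (c * r1) <= 1 * (c * r1).
      by rewrite ler_pM2r ?mulr_gt0//; have := hrho _ hh; clear -rho16; lra.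
    by rewrite expr2; clear -e1 e2; lra.
(* The multiplier is the Rayleigh quotient, the value forced by pairing the eigen-equation with a
   unit vector. *)
exists r, h0, abar, bbar, (fun h => (z h).1), (fun h => (z h).2),
  (fun h => dotp (z h).2 (curv g h (z h).1 (z h).2)).
split=> // h hp hh; have := zP h hp hh; move: (z h) => [xh vh] /= [crit_h xh1 G0] {zP z}.
have [[_ _ vh1] s0] := crit_h.
have hr1 : h <= r1 := le_trans hh h0r1.
have vhs : `|vh - vs| <= sg.
  have H := critical_near norm_vs rho_gt0 bb0 (CV h hp hh) (VN h hp hh) crit_h xh1
    (le_trans r2r1 r2rho).
  rewrite -(ler_pM2l c0); apply: (le_trans H); apply: le_trans r1c'.
  by rewrite ler_pM2l// ler_pM2l// lerD2l.
have xh1' : `|xs - xh| <= r1 by rewrite distrC.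
have ball_le (p q : X) : ball p r q -> `|q - p| <= r.
  by rewrite -ball_normE/= distrC => /ltW.
split.
- split; [by rewrite dimer_gradxE| |exact: vh1].
  rewrite curvE//; move/eqP: s0; rewrite /rotation_dir oppr_eq0 subr_eq0 => /eqP.
  exact.
- move=> x0 v0 alpha beta /ball_le x0r /ball_le v0r v01.
  move=> /admissible_stepsP[a0 a0p ha] /admissible_stepsP[b0 b0p hb].
  pose x k := (algorithm1 E h alpha beta x0 v0 k).1.
  pose w k := (algorithm1 E h alpha beta x0 v0 k).2.
  have xS k : x k.+1 = xstep g h (alpha k) (x k) (w k).
    rewrite -(dimer_step_xE h E1) /x /w /=.
    by case: (algorithm1 E h alpha beta x0 v0 k).
  have wS k : w k.+1 = vstep g h (beta k) (x k) (w k).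
    rewrite -(dimer_step_vE E1 hp); last by have /andP[+ _] := hb k; apply: lt_le_trans.
    rewrite /x /w /=; by case: (algorithm1 E h alpha beta x0 v0 k).
  pose m := Num.max `|x0 - xh| (delta * `|v0 - vh|).
  have x0h : `|x0 - xh| <= r + r1.
    by have -> : x0 - xh = (x0 - xs) + (xs - xh); [rewrite addrA subrK|exact: normD_le].
  have v0h : `|v0 - vh| <= r + sg.
    have -> : v0 - vh = (v0 - vs) + (vs - vh) by rewrite addrA subrK.
    by apply: normD_le => //; rewrite distrC.
  have m2 : m <= 2 * sg.
    rewrite ge_max; apply/andP; split; first by clear -x0h rsg r1r; lra.
    have : delta * `|v0 - vh| <= 1 * `|v0 - vh| by rewrite ler_wpM2r.
    clear -v0h rsg; lra.
  have m_sum : m <= `|x0 - xh| + `|v0 - vh|.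
    rewrite ge_max lerDl normr_ge0/=.
    have : delta * `|v0 - vh| <= 1 * `|v0 - vh| by rewrite ler_wpM2r.
    by have := normr_ge0 (x0 - xh); clear; lra.
  have [||||eta eta01 H] := alternating_convergence c0 abc bbc (CX h hp hh) (CV h hp hh)
    crit_h G0 d0 dK eps1 a0p ha b0p hb v01 xS wS (m := m).
  + by rewrite /m le_max lexx.
  + by rewrite /m le_max lexx orbT.
  + by clear -m2 xh1 r1r rsg sgrho sg0; lra.
  + have : m / delta <= rho / 2 by rewrite ler_pdivrMr//; clear -m2 sgd; lra.
    by clear -vhs sgrho rho_gt0; lra.
  (* The cost of passing from the weighted maximum back to the sum of the errors. *)
  exists (1 + delta^-1), eta; split=> //; first by rewrite addr_gt0// invr_gt0.
  move=> k; have [h1 h2] := H k.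
  have h3 : `|w k - vh| <= m * eta ^+ k / delta by rewrite ler_pdivlMr// mulrC.
  apply: (le_trans (lerD h1 h3)).
  have e0 : 0 <= (1 + delta^-1) * eta ^+ k.
    have /andP[eta0 _] := eta01.
    by rewrite mulr_ge0 ?addr_ge0 ?invr_ge0 ?exprn_ge0// ltW.
  by have := ler_wpM2l e0 m_sum; clear; lra.
move=> x0 alpha /ball_le x0r /admissible_stepsP[a0 a0p ha].
have /choice[vb vbP] : forall x, exists v, `|x - xs| <= r2 -> crit h x v.
  move=> x; have [xr|/negP xr] := boolP (`|x - xs| <= r2); last by exists 0.
  have [|w cw] := critical_exists norm_vs rho_gt0 c0 bb0 bbc (CV h hp hh) (VN h hp hh)
    (RD h hp hh) r2rho _ xr; last by exists w.
  have : L * (r2 + h) <= L * (r2 + r2).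
    by rewrite ler_pM2l//; clear -r2r1 hr1; lra.
  clear -r2c; lra.
have argmin x : `|x - xs| <= r2 -> dimer_argmin E h x = [set vb x; - vb x].
  move=> xr; have [xreg sv] := vbP x xr.
  exact: (dimer_argminE A_sym A_vs norm_vs coer kap0 L0 M0 A_le F1 F3 hp (hrho _ hh)
    rho16 rho2 q2rho xreg sv).
have near x : `|x - xh| <= r + r1 -> `|x - xs| <= r2.
  move=> xx; have -> : x - xs = (x - xh) + (xh - xs) by rewrite addrA subrK.
  by apply: (le_trans (normD_le xx xh1)); clear -rr2 r1r; lra.
have x0h : `|x0 - xh| <= r + r1.
  by have -> : x0 - xh = (x0 - xs) + (xs - xh); [rewrite addrA subrK|exact: normD_le].
pose eta := 1 - a0 * c / 2.
have eta01 : 0 < eta < 1.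
  have /andP[h1 h2] := ha 0%N.
  have : a0 * c <= abar * c by rewrite ler_pM2r// (le_trans h1).
  have : 0 < a0 * c by rewrite mulr_gt0.
  by clear -abc; rewrite /eta => *; apply/andP; split; lra.
have step k x : `|x - xh| <= r + r1 ->
    `|xstep g h (alpha k) x (vb x) - xh| <= eta * `|x - xh|.
  move=> xx; have /andP[a1 a2] := ha k.
  have ap : 0 <= alpha k by rewrite (le_trans (ltW a0p)).
  have := critical_xstep c0 bb0 (CX h hp hh) (CV h hp hh) (ltW eps0) eps2
    (vbP x (near _ xx)) crit_h ap a2.
  rewrite (xstep_zero _ G0) => /le_trans; apply; apply: ler_wpM2r => //.
  have : a0 * c <= alpha k * c by rewrite ler_pM2r.
  by clear; rewrite /eta; lra.
(* The minimisers are identified only within [r2], so the recursion is assumed only there and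
   confinement is proved along with it. This serves both the constructed sequence and an arbitrary
   run of Algorithm 2. *)
have stay (x : nat -> X) : x 0%N = x0 ->
    (forall k, `|x k - xs| <= r2 -> x k.+1 = xstep g h (alpha k) (x k) (vb (x k))) ->
    forall k, `|x k - xh| <= r + r1.
  move=> x00 xS; elim=> [|k IH]; first by rewrite x00.
  rewrite xS; last exact: near.
  apply: (le_trans (step k _ IH)); apply: le_trans IH.
  by have /andP[_ /ltW e1] := eta01; rewrite ler_piMl.
split.
  pose xx := nat_rect (fun=> X) x0 (fun k y => xstep g h (alpha k) y (vb y)).
  have xxn k : `|xx k - xh| <= r + r1 by apply: stay.
  exists xx, (fun k => vb (xx k)); split=> // k.
    by rewrite argmin; [left|exact: near].
  by rewrite dimer_step_xE.
move=> x w [x00 wargmin xS].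
have wvb k : `|x k - xs| <= r2 -> w k = vb (x k) \/ w k = - vb (x k).
  by move=> xr; have := wargmin k; rewrite argmin.
have xE k : `|x k - xs| <= r2 -> x k.+1 = xstep g h (alpha k) (x k) (vb (x k)).
  move=> xr; rewrite xS dimer_step_xE//.
  by have [->|->] := wvb k xr; rewrite ?xstep_even.
have xn := stay x x00 xE.
have xr k : `|x k - xs| <= r2 by exact: near.
split.
- move=> k; rewrite argmin//; have [->|->] := wvb k (xr k); first by [].
  by rewrite opprK setUC.
- exists eta => // k; rewrite xE//; exact: step.
(* The Lipschitz constant of the critical direction; the minimum over signs matches whichever
   minimiser was taken. *)
- exists (K / c) => k.
  have lip := critical_lipschitz bb0 (CV h hp hh) (vbP _ (xr k)) crit_h.
  have {}lip : `|vb (x k) - vh| <= K / c * `|x k - xh|.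
    by rewrite mulrAC ler_pdivlMr// mulrC.
  rewrite ge_min; have [->|->] := wvb k (xr k); first by rewrite lip.
  have -> : - vb (x k) + vh = - (vb (x k) - vh) by rewrite opprB addrC.
  by rewrite normrN lip orbT.
Qed.
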